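(* Every locally compact topological ring is unconditionally seminormable and Hirsch.
   Context: A topological ring is an Abelian topological group $R$ (written additively, identity $0$) endowed with a continuous associative binary operation which is distributive over addition on both sides (no unit and no commutativity of multiplication is assumed). It is locally compact if every element has a compact neighborhood. A seminorm on an Abelian topological group $G$ is a continuous function $\|\cdot\|:G\to[0,\infty)$ with $\|0\|=0$, $\|-x\|=\|x\|$ and $\|x+y\|\le\|x\|+\|y\|$ for all $x,y\in G$. A topological ring $R$ is unconditionally seminormable if for every neighborhood $U\subseteq R$ of $0$ there exist a seminorm $\|\cdot\|:R\to[0,\infty)$ on the additive group of $R$, a neighborhood $V\subseteq R$ of $0$, and positive real numbers $C,\varepsilon$ such that $\{x\in R:\|x\|<\varepsilon\}\subseteq U$ and for any finite set $F$ and sequences $(x_i)_{i\in F}\in R^F$ and $(a_i)_{i\in F}\in V^F$ with $M:=\max_{E\subseteq F}\|\sum_{i\in E}x_i\|\le\varepsilon$ we have $\|\sum_{i\in F}a_ix_i\|\le CM$. A series $\sum_{n\in\omega}x_n$ in an Abelian topological group $G$ unconditionally converges to $x\in G$ if for any neighborhood $U$ of $0$ there is a finite set $F\subset\omega$ such that $\sum_{i\in J}x_i\in x+U$ for any finite set $J\subset\omega$ containing $F$; it is unconditionally convergent if it unconditionally converges to some $x\in G$. A topological ring $R$ is Hirsch if for any unconditionally convergent series $\sum_{n\in\omega}x_n$ in $R$ and any neighborhood $U\subseteq R$ of $0$ there exists a neighborhood $V\subseteq R$ of $0$ such that $\sum_{n\in F}a_nx_n\in U$ for any finite set $F\subset\omega$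 and any sequence $(a_n)_{n\in F}\in V^F$. *)

(* Defs.v *)
From HB Require Import structures.
From mathcomp Require Import all_boot all_order all_algebra finmap.
From mathcomp Require Import all_classical all_reals all_analysis.

Set Implicit Arguments.
Unset Strict Implicit.
Unset Printing Implicit Defensive.

Import Order.TTheory GRing.Theory Num.Theory.
Import numFieldTopology.Exports.

Local Open Scope classical_set_scope.
Local Open Scope ring_scope.

(* MathComp's ring structures all have a unit, so the multiplication is added
   directly on top of a topological abelian group. No separation axiom. *)
HB.mixin Record TopologicalZmodule_isTopologicalRng M
    & TopologicalZmodule M := {
  rng_mul : M -> M -> M ;
  rng_mulA : associative rng_mul ;
  rng_mulDl : left_distributive rng_mul +%R ;
  rng_mulDr : right_distributive rng_mul +%R ;
  rng_mul_continuous : continuous (fun z : M * M => rng_mul z.1 z.2) ;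
}.

#[short(type="topologicalRngType")]
HB.structure Definition TopologicalRng :=
  {M of TopologicalZmodule M & TopologicalZmodule_isTopologicalRng M}.

Declare Scope rng_scope.
Delimit Scope rng_scope with rng.
Notation "x * y" := (rng_mul x y) : rng_scope.

(* Unlike [locally_compact [set: T]], the compact neighborhood is not required
   to be closed (the space need not be Hausdorff). *)
Definition locally_compact_space (T : topologicalType) : Prop :=
  forall x : T, exists2 A : set T, nbhs x A & compact A.

Definition is_seminorm (K : realType) (G : topologicalZmodType) (N : G -> K)
    : Prop :=
  [/\ continuous N,
      forall x, 0 <= N x,
      N 0 = 0,
      forall x, N (- x) = N x
    & forall x y, N (x + y) <= N x + N y].

(* The default value 0 of the big maximum is harmless: N is nonnegative and
   E = set0 contributes N 0 = 0. *)
Definition max_subsum (K : realType) (G : zmodType) (N : G -> K)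
    (F : finType) (x : F -> G) : K :=
  \big[Num.max/0]_(E : {set F}) N (\sum_(i in E) x i).

Definition unconditionally_seminormable (K : realType)
    (R : topologicalRngType) : Prop :=
  forall U : set R, nbhs 0 U ->
  exists (N : R -> K) (V : set R) (C eps : K),
    [/\ is_seminorm N,
        nbhs 0 V,
        0 < C /\ 0 < eps,
        [set x | N x < eps] `<=` U
      & forall (F : finType) (x a : F -> R),
          (forall i, V (a i)) ->
          max_subsum N x <= eps ->
          N (\sum_(i : F) (a i * x i)%rng) <= C * max_subsum N x].

Definition unconditionally_converges_to (G : topologicalZmodType)
    (x : nat -> G) (l : G) : Prop :=
  forall U : set G, nbhs 0 U ->
  exists F : {fset nat}, forall J : {fset nat}, (F `<=` J)%fset ->
    [set l + u | u in U] (\sum_(i <- J) x i).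

Definition unconditionally_convergent (G : topologicalZmodType)
    (x : nat -> G) : Prop :=
  exists l : G, unconditionally_converges_to x l.

(* Only the values of a on F matter, so a is a total sequence. *)
Definition hirsch (R : topologicalRngType) : Prop :=
  forall x : nat -> R, unconditionally_convergent x ->
  forall U : set R, nbhs 0 U ->
  exists2 V : set R, nbhs 0 V &
    forall (F : {fset nat}) (a : nat -> R),
      (forall n, n \in F -> V (a n)) -> U (\sum_(n <- F) (a n * x n)%rng).

(* Main.v *)
(** * Idea

   Everything follows from a seminorm sg on R whose unit ball lies in a given neighborhood and traps cyclic subgroups: a cyclic subgroup inside {sg <= 1} lies
   in {sg = 0}. By compactness there is c such that z, 2z, ..., cz in {sg <= 1}
   forces sg z <= 1/4, hence the sets
     B_n = { x | sg (j x) <= 1/4 for all j <= c^n }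
   satisfy B_(n+1) + B_(n+1) + B_(n+1) <= B_n, and Birkhoff-Kakutani turns them into
   a seminorm N. The B_n are homogeneous: x in B_n iff j x in B_0 for all j <= c^n.
   So it suffices to bound sum_i a_i x_i by B_0 when all partial sums of x lie in
   B_0; replacing x by j x gives the linear bound. For coefficients, the
   analogous sets A_n of a second seminorm satisfy: A_n is covered by m translates
   b_k + A_(n+1) with b_k in A_n and m independent of n. Writing a_i = b_k + a'_i
   groups the sum into m products b_k y_k, with y_k a partial sum of the x_i, plus
   a sum with coefficients in A_(n+1); iterating, the errors sum up like a
   geometric series.

   The trapping seminorm is where local compactness is really needed. It replaces the
   structure theory of locally compact abelian groups: on a totally bounded
   subgroup S, Bogolyubov's argument on finite groups (Z/L)^n, mapped to S by
   x |-> sum_i x_i z_i with all L z_i almost 0, gives N_L(x) = max |1 - chi(x)| over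
   the characters chi in the large spectrum of a bump function, and an ultralimit
   of these is a seminorm on S expanding by 3/2 under doubling near 0. *)

Require Import Defs.
From mathcomp Require Import all_boot all_order all_algebra.
From mathcomp Require Import all_classical all_reals all_analysis.
From mathcomp Require Import ring lra zify.
From mathcomp Require Import finmap.
From mathcomp Require Import complex.
From mathcomp Require cyclic separable cyclotomic.

Set Implicit Arguments.
Unset Strict Implicit.
Unset Printing Implicit Defensive.

Import Order.TTheory GRing.Theory Num.Theory.
Import numFieldTopology.Exports.

Local Open Scope classical_set_scope.
Local Open Scope ring_scope.

(** * Seminorms on abelian groups *)

Definition zseminorm (K : realType) (G : zmodType) (N : G -> K) : Prop :=
  [/\ forall x, 0 <= N x,
      N 0 = 0,
      forall x, N (- x) = N x
    & forall x y, N (x + y) <= N x + N y].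

Lemma zseminormB (K : realType) (G : zmodType) (N : G -> K) :
  zseminorm N -> forall x y, N (x - y) <= N x + N y.
Proof. by case=> _ _ NN ND x y; rewrite -(NN y); apply: ND. Qed.

Lemma zseminormBC (K : realType) (G : zmodType) (N : G -> K) :
  zseminorm N -> forall x y, N (x - y) = N (y - x).
Proof. by case=> _ _ NN ND x y; rewrite -NN opprB. Qed.

Lemma zseminorm_sum (K : realType) (G : zmodType) (N : G -> K) (I : Type)
    (s : seq I) (P : pred I) (f : I -> G) :
  zseminorm N -> N (\sum_(i <- s | P i) f i) <= \sum_(i <- s | P i) N (f i).
Proof.
case=> N0 N00 NN ND; elim/big_rec2: _ => [|i a b _ le_ba]; first by rewrite N00.
by apply: le_trans (ND _ _) _; rewrite lerD2l.
Qed.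

Lemma zseminormMn (K : realType) (G : zmodType) (N : G -> K) (m : nat) x :
  zseminorm N -> N (x *+ m) <= N x *+ m.
Proof.
case=> N0 N00 NN ND; elim: m => [|m IHm]; first by rewrite !mulr0n N00.
by rewrite !mulrS; apply: le_trans (ND _ _) _; rewrite lerD2l.
Qed.

Lemma zseminorm_dist (K : realType) (G : zmodType) (N : G -> K) x y :
  zseminorm N -> `|N x - N y| <= N (x - y).
Proof.
move=> sN; have [N0 N00 NN ND] := sN.
have h a b : N a - N b <= N (a - b).
  by rewrite lerBlDr -[X in N X <= _](subrK b); apply: ND.
by rewrite ler_norml h andbT lerNl opprB (le_trans (h _ _))// zseminormBC.
Qed.

Lemma zseminormZ (K : realType) (G : zmodType) (N : G -> K) (r : K) :
  0 <= r -> zseminorm N -> zseminorm (fun x => r * N x).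
Proof.
move=> r0 [N0 N00 NN ND]; split=> [x||x|x y].
- exact: mulr_ge0.
- by rewrite N00 mulr0.
- by rewrite NN.
- by rewrite -mulrDr ler_wpM2l.
Qed.

Definition gen_seminorm (K : realType) (G : zmodType) (q : G -> K) (x : G)
    : K :=
  inf [set r | exists2 s : seq G,
    \sum_(y <- s) y = x & \sum_(y <- s) q y = r].

Lemma gen_seminorm_has_inf (K : realType) (G : zmodType) (q : G -> K) x :
  (forall y, 0 <= q y) ->
  has_inf [set r | exists2 s : seq G,
    \sum_(y <- s) y = x & \sum_(y <- s) q y = r].
Proof.
move=> q0; split.
  by exists (q x); exists [:: x]; rewrite big_seq1.
by exists 0 => _ [s _ <-]; apply: sumr_ge0.
Qed.

Lemma gen_seminorm_sum (K : realType) (G : zmodType) (q : G -> K) s :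
  (forall y, 0 <= q y) ->
  gen_seminorm q (\sum_(y <- s) y) <= \sum_(y <- s) q y.
Proof.
move=> q0; apply: ge_inf; last by exists s.
by have [] := gen_seminorm_has_inf (\sum_(y <- s) y) q0.
Qed.

Lemma gen_seminorm_le (K : realType) (G : zmodType) (q : G -> K) x :
  (forall y, 0 <= q y) -> gen_seminorm q x <= q x.
Proof. by move=> q0; have := gen_seminorm_sum [:: x] q0; rewrite !big_seq1. Qed.

Lemma gen_seminorm_lt (K : realType) (G : zmodType) (q : G -> K) x r :
  (forall y, 0 <= q y) -> gen_seminorm q x < r ->
  exists2 s : seq G, \sum_(y <- s) y = x & \sum_(y <- s) q y < r.
Proof.
move=> q0; rewrite -subr_gt0 => e0.
have [_ [s sx <-]] := inf_adherent e0 (gen_seminorm_has_inf x q0).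
by rewrite -/(gen_seminorm q x) addrC subrK; exists s.
Qed.

Lemma gen_seminormP (K : realType) (G : zmodType) (q : G -> K) :
  (forall y, 0 <= q y) -> (forall y, q (- y) = q y) ->
  zseminorm (gen_seminorm q).
Proof.
move=> q0 qN.
have N0 x : 0 <= gen_seminorm q x.
  apply: lb_le_inf; first by have [] := gen_seminorm_has_inf x q0.
  by move=> _ [s _ <-]; apply: sumr_ge0.
have NN x : gen_seminorm q (- x) <= gen_seminorm q x.
  apply/ler_addgt0Pr => e e0.
  have [|s <- qs] := @gen_seminorm_lt _ _ q x (gen_seminorm q x + e) q0.
    by rewrite ltrDl.
  apply: le_trans (ltW qs); rewrite -sumrN.
  have := gen_seminorm_sum [seq - y | y <- s] q0; rewrite !big_map.
  by under [X in _ <= X]eq_bigr do rewrite qN.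
split=> //.
- apply/eqP; rewrite eq_le N0 andbT.
  by have := gen_seminorm_sum [::] q0; rewrite !big_nil.
- by move=> x; apply/eqP; rewrite eq_le NN -{1}(opprK x) NN.
- move=> x y; apply/ler_addgt0Pr => e e0.
  have e2 : 0 < e / 2 by rewrite divr_gt0.
  have [|s <- qs] := @gen_seminorm_lt _ _ q x (gen_seminorm q x + e / 2) q0.
    by rewrite ltrDl.
  have [|t <- qt] := @gen_seminorm_lt _ _ q y (gen_seminorm q y + e / 2) q0.
    by rewrite ltrDl.
  rewrite -big_cat; apply: le_trans (gen_seminorm_sum _ q0) _.
  by rewrite big_cat/= (le_trans (lerD (ltW qs) (ltW qt)))//; lra.
Qed.

(** Three summands rather than two: cutting a sum near half of its total leaves two outer parts and
    one term in the middle. *)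
Definition tchain (G : zmodType) (B : nat -> set G) : Prop :=
  [/\ forall n, B n 0,
      forall n x, B n x -> B n (- x)
    & forall n x y z, B n.+1 x -> B n.+1 y -> B n.+1 z -> B n (x + y + z)].

Lemma tchain_sub (G : zmodType) (B : nat -> set G) m n :
  tchain B -> (m <= n)%N -> B n `<=` B m.
Proof.
case=> B0 _ B3; elim: n => [|n IHn]; first by rewrite leqn0 => /eqP ->.
rewrite leq_eqVlt => /orP[/eqP -> //|]; rewrite ltnS => /IHn mn x Bx.
by apply: mn; rewrite -[x]addr0 -[x]addr0; apply: B3.
Qed.

Lemma exists_exp2N_lt (K : realType) (e : K) :
  0 < e -> exists n, 2^-1 ^+ n < e.
Proof.
move=> e0; have [n] : exists n : nat, e^-1 < n%:R.
  by exists (Num.bound e^-1); apply: archi_boundP; rewrite invr_ge0 ltW.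
move=> en; exists n; rewrite exprVn invf_plt ?posrE ?exprn_gt0//.
by apply: (lt_trans en); rewrite -natrX ltr_nat ltn_expl.
Qed.

(** The disjunct [n = 0] keeps the set nonempty when x lies in no [B n]; the gauge is 1 there. *)
Definition chain_gauge (K : realType) (G : zmodType) (B : nat -> set G)
    (x : G) : K :=
  inf [set 2^-1 ^+ n | n in [set n | n = 0%N \/ B n x]].

Lemma chain_gauge_has_inf (K : realType) (G : zmodType) (B : nat -> set G)
    (x : G) :
  has_inf [set (2^-1 ^+ n : K) | n in [set n | n = 0%N \/ B n x]].
Proof.
split; first by exists 1; exists 0%N => //; left.
by exists 0 => _ [n _ <-]; rewrite exprn_ge0.
Qed.

Lemma chain_gauge_ge0 (K : realType) (G : zmodType) (B : nat -> set G) x :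
  0 <= chain_gauge K B x.
Proof.
apply: lb_le_inf; first by have [] := @chain_gauge_has_inf K G B x.
by move=> _ [n _ <-]; rewrite exprn_ge0.
Qed.

Lemma chain_gaugeN (K : realType) (G : zmodType) (B : nat -> set G) x :
  tchain B -> chain_gauge K B (- x) = chain_gauge K B x.
Proof.
case=> _ BN _; rewrite /chain_gauge; congr inf; apply/seteqP.
by split=> _ [n [nx|nx] <-]; exists n => //;
   [left|right; rewrite -(opprK x); apply: BN|left|right; apply: BN].
Qed.

Lemma chain_gauge_le (K : realType) (G : zmodType) (B : nat -> set G) x n :
  B n x -> chain_gauge K B x <= 2^-1 ^+ n.
Proof.
move=> Bx; apply: ge_inf; first by have [] := @chain_gauge_has_inf K G B x.
by exists n => //; right.
Qed.

(** An infimum of powers of 1/2 that is strictly below one power is undercut by a later one, which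
    gains a level. *)
Lemma chain_gauge_lt (K : realType) (G : zmodType) (B : nat -> set G) x n :
  tchain B -> chain_gauge K B x < 2^-1 ^+ n -> B n.+1 x.
Proof.
move=> tB; move/(inf_lt _) => [|_ [m Bm <-]].
  by have [] := @chain_gauge_has_inf K G B x.
move=> mn.
have {}mn : (n < m)%N.
  rewrite ltnNge; apply/negP => le_mn; move: mn; rewrite ltNge => /negP; apply.
  by rewrite ler_wiXn2l//; lra.
case: Bm => [m0|]; first by rewrite m0 in mn.
exact: tchain_sub.
Qed.

Lemma sum_cut (K : realType) (T : Type) (q : T -> K) (s : seq T) (r : K) :
  0 <= r -> r < \sum_(y <- s) q y ->
  exists t1 x t2, [/\ s = t1 ++ x :: t2, \sum_(y <- t1) q y <= r &
    r < \sum_(y <- t1) q y + q x].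
Proof.
elim: s r => [|x s IHs] r r0; first by rewrite big_nil ltNge r0.
rewrite big_cons => rs; have [lt_rx|le_xr] := ltP r (q x).
  by exists [::], x, s; rewrite big_nil add0r.
have [||t1 [y [t2 [-> h1 h2]]]] := IHs (r - q x); first by rewrite subr_ge0.
  by rewrite ltrBlDl.
exists (x :: t1), y, t2; rewrite big_cons; split=> //.
  by rewrite -lerBrDl.
by rewrite -addrA -ltrBlDl.
Qed.

(* Cut the sum at the term where the gauges pass half of the total: both outer
   parts and the middle term lie one level deeper. *)
Lemma chain_gauge_sum (K : realType) (G : zmodType) (B : nat -> set G)
    (s : seq G) n :
  tchain B -> \sum_(y <- s) chain_gauge K B y < 2^-1 ^+ n ->
  B n (\sum_(y <- s) y).
Proof.
move=> tB; have [B0 BN B3] := tB.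
have q0 := @chain_gauge_ge0 K G B.
have [k] := ubnP (size s); elim: k => // k IHk in s n *; rewrite ltnS => sk sn.
have s0 (t : seq G) : 0 <= \sum_(y <- t) chain_gauge K B y by apply: sumr_ge0.
have e2 : (2^-1 : K) ^+ n = 2 * 2^-1 ^+ n.+1 by rewrite exprS mulrA divff ?mul1r.
suff [->|[t1 [x [t2 [st h1 h2]]]]] : s = [::] \/
    exists t1 x t2, [/\ s = t1 ++ x :: t2,
      \sum_(y <- t1) chain_gauge K B y < 2^-1 ^+ n.+1 &
      \sum_(y <- t2) chain_gauge K B y < 2^-1 ^+ n.+1].
- by rewrite big_nil; apply: B0.
- rewrite st big_cat big_cons/= addrA; move: sk sn.
  rewrite st size_cat/= big_cat big_cons/= => sk sn.
  have qx : chain_gauge K B x < 2^-1 ^+ n.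
    by have := s0 t1; have := s0 t2; lra.
  apply: B3; [apply: IHk => // | exact: chain_gauge_lt qx | apply: IHk => //].
    by apply: leq_trans sk; rewrite addnS ltnS leq_addr.
  by apply: leq_trans sk; rewrite addnS ltnS leq_addl.
- set r := \sum_(y <- s) chain_gauge K B y in sn; have := s0 s; rewrite -/r.
  (* [sum_cut] at r / 2 needs r > 0; a zero total is cut at its first term instead. *)
  rewrite le_eqVlt => /orP[/eqP r0|r0].
    case: s @r sk sn r0 => [|x t] r sk sn r0; [by left|right].
    exists [::], x, t; split=> //; first by rewrite big_nil exprn_gt0.
    apply: le_lt_trans (_ : r < _); last by rewrite -r0 exprn_gt0.
    by rewrite /r big_cons lerDr.
  right; have [||t1 [x [t2 [st h1 h2]]]] := @sum_cut K G (chain_gauge K B) s (r / 2).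
  - by lra.
  - by rewrite -/r; lra.
  - exists t1, x, t2; split=> //; first by lra.
    have : r = \sum_(y <- t1) chain_gauge K B y + (chain_gauge K B x +
        \sum_(y <- t2) chain_gauge K B y) by rewrite /r st big_cat big_cons.
    by lra.
Qed.

(** The upper bound on N is inherited from the gauge; the inclusion of balls is [chain_gauge_sum]
    applied to a decomposition of x that nearly attains the infimum. *)
Lemma birkhoff_kakutani (K : realType) (G : zmodType) (B : nat -> set G) :
  tchain B -> exists N : G -> K, [/\ zseminorm N,
    forall n x, N x < 2^-1 ^+ n -> B n x &
    forall n x, B n x -> N x <= 2^-1 ^+ n].
Proof.
move=> tB; have q0 := @chain_gauge_ge0 K G B.
exists (gen_seminorm (chain_gauge K B)); split.
- by apply: gen_seminormP => // y; apply: chain_gaugeN.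
- by move=> n x /(gen_seminorm_lt q0)[s <-]; apply: chain_gauge_sum.
- move=> n x Bx; apply: le_trans (gen_seminorm_le _ q0) _.
  exact: chain_gauge_le.
Qed.

(** * Continuous seminorms on topological groups *)

Lemma zseminorm_continuous (K : realType) (G : topologicalZmodType)
    (N : G -> K) :
  zseminorm N -> (forall e, 0 < e -> nbhs 0 [set x | N x < e]) ->
  continuous N.
Proof.
move=> sN N0 x; apply/cvgrPdist_lt => e e0.
have : nbhs (x - x) [set x | N x < e] by rewrite subrr; apply: N0.
move=> /(@sub_continuous G (x, x)) [[P Q] [/= Px Qx] PQ].
near=> y; apply: le_lt_trans (zseminorm_dist _ _ sN) _.
apply: (PQ (x, y)); split=> /=; [exact: nbhs_singleton|by near: y].
Unshelve. all: by end_near.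
Qed.

Lemma zseminorm_is_seminorm (K : realType) (G : topologicalZmodType)
    (N : G -> K) :
  zseminorm N -> (forall e, 0 < e -> nbhs 0 [set x | N x < e]) ->
  is_seminorm N.
Proof.
by move=> sN Ne; have := zseminorm_continuous sN Ne; case: sN; split.
Qed.

Lemma is_seminorm_zseminorm (K : realType) (G : topologicalZmodType)
    (N : G -> K) : is_seminorm N -> zseminorm N.
Proof. by case. Qed.

Lemma is_seminorm_nbhs (K : realType) (G : topologicalZmodType)
    (N : G -> K) x e : is_seminorm N -> N x < e -> nbhs x [set y | N y < e].
Proof. by case=> cN _ _ _ _ Ne; exact: cvgr_lt (cN x) _ Ne. Qed.

Lemma nbhs0_third (G : topologicalZmodType) (U : set G) : nbhs 0 U ->
  exists V : set G, [/\ nbhs 0 V, forall x, V x -> V (- x) &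
    forall x y z, V x -> V y -> V z -> U (x + y + z)].
Proof.
have half (W : set G) : nbhs 0 W ->
    exists2 V, nbhs 0 V & forall x y, V x -> V y -> W (x + y).
  rewrite -{1}[0 in X in X -> _](addr0 (0 : G)).
  move=> /(@add_continuous G (0, 0)) [[P Q] [/= P0 Q0] PQ].
  exists (P `&` Q); first exact: filterI.
  by move=> x y [Px _] [_ Qy]; apply: (PQ (x, y)).
move=> /half[V V0 VU]; have [W W0 WV] := half _ V0.
have V0' := nbhs_singleton V0.
have W0N : nbhs 0 [set x | W (- x)].
  by apply: (@opp_continuous G 0); rewrite oppr0.
exists ((W `&` V) `&` [set x | (W `&` V) (- x)]); split.
- apply: filterI; first exact: filterI.
  by apply: (@opp_continuous G 0); rewrite oppr0; apply: filterI.
- by move=> x [h1 h2]; split=> //=; rewrite opprK.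
- by move=> x y z [[Wx _] _] [[Wy _] _] [[_ Vz] _]; apply: VU => //; apply: WV.
Qed.

(** Iterated thirds of U form a chain of neighborhoods of 0, and Birkhoff-Kakutani applies to it.
    The chain is no base at 0 in general: N is continuous but does not define the topology. *)
Lemma nbhs0_seminorm (K : realType) (G : topologicalZmodType) (U : set G) :
  nbhs 0 U -> exists2 N : G -> K, is_seminorm N & [set x | N x < 1] `<=` U.
Proof.
move=> U0.
pose T := {V : set G | nbhs 0 V /\ forall x, V x -> V (- x)}.
have step (V : T) : exists W : T,
    forall x y z, sval W x -> sval W y -> sval W z -> sval V (x + y + z).
  case: V => V [V0 VN] /=; have [W [W0 WN W3]] := nbhs0_third V0.
  by exists (exist _ W (conj W0 WN)).
have [f fP] := choice step.
have [V0 [V00 V0N V03]] := nbhs0_third U0.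
pose B n := sval (iter n f (exist _ V0 (conj V00 V0N) : T)).
have Bnbhs n : nbhs 0 (B n) by rewrite /B; case: (iter _ _ _) => V [].
have tB : tchain B.
  split=> [n|n x|n x y z]; first exact: nbhs_singleton.
    by rewrite /B; case: (iter _ _ _) => V [/= _]; apply.
  exact: fP.
have [N [sN N1 N2]] := birkhoff_kakutani K tB.
exists N.
  apply: zseminorm_is_seminorm => // e /exists_exp2N_lt[n ne].
  by apply: filterS (Bnbhs n) => x /N2 Nx; apply: le_lt_trans ne.
move=> x /(N1 0%N x) V0x; rewrite -[x]addr0 -[x]addr0.
by apply: V03 => //; apply: nbhs_singleton.
Qed.

(** * Fourier analysis on finite abelian groups *)

(** The dual group as an indexed family of unitary characters. The last clause is orthogonality over
    the characters at a fixed point, the form that Parseval and Bogolyubov use. *)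
Definition dual_family (C : numClosedFieldType) (Gam : finZmodType)
    (I : finType) (chi : I -> Gam -> C) : Prop :=
  [/\ forall k x y, chi k (x + y) = chi k x * chi k y,
      forall k x, `|chi k x| = 1,
      exists k, forall x, chi k x = 1
    & forall x, \sum_k chi k x = if x == 0 then #|Gam|%:R else 0].

Definition fourier (C : numClosedFieldType) (Gam : finZmodType)
    (I : finType) (chi : I -> Gam -> C) (f : Gam -> C) (k : I) : C :=
  #|Gam|%:R^-1 * \sum_x f x * chi k x.

Lemma finzmod_card_gt0 (C : numClosedFieldType) (Gam : finZmodType) :
  0 < #|Gam|%:R :> C.
Proof. by rewrite ltr0n; apply/card_gt0P; exists 0. Qed.

Lemma dual_family0 (C : numClosedFieldType) (Gam : finZmodType)
    (I : finType) (chi : I -> Gam -> C) k :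
  dual_family chi -> chi k 0 = 1.
Proof.
case=> chiD chi1 _ _; have := chiD k 0 0; rewrite addr0.
have : chi k 0 != 0 by rewrite -normr_eq0 chi1 oner_eq0.
by move=> n0 /esym/eqP; rewrite -{3}[chi k 0]mulr1 (inj_eq (mulfI n0)) => /eqP.
Qed.

Lemma dual_familyN (C : numClosedFieldType) (Gam : finZmodType)
    (I : finType) (chi : I -> Gam -> C) k x :
  dual_family chi -> chi k (- x) = (chi k x)^*.
Proof.
move=> dc; have [chiD chi1 _ _] := dc.
have nz : chi k x != 0 by rewrite -normr_eq0 chi1 oner_eq0.
apply: (mulfI nz); rewrite -chiD subrr (dual_family0 _ dc) -normCK chi1.
by rewrite expr1n.
Qed.

Lemma fourier_sqr (C : numClosedFieldType) (Gam : finZmodType)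
    (I : finType) (chi : I -> Gam -> C) (f : Gam -> C) k :
  dual_family chi -> (forall x, 0 <= f x) ->
  `|fourier chi f k| ^+ 2 = #|Gam|%:R^-1 ^+ 2 *
    \sum_x \sum_y f x * f y * chi k (x - y).
Proof.
move=> dc f0; have [chiD chi1 _ _] := dc.
have n0 := finzmod_card_gt0 C Gam.
rewrite normCK rmorphM/= (geC0_conj (x := _^-1)) ?invr_ge0 ?(ltW n0)//.
rewrite mulrACA -expr2; congr (_ * _).
rewrite rmorph_sum/= mulr_suml; apply: eq_bigr => x _.
rewrite mulr_sumr; apply: eq_bigr => y _.
rewrite rmorphM/= chiD (dual_familyN _ _ dc) (geC0_conj (f0 y)); ring.
Qed.

(** Summing the expanded squares over k kills the off-diagonal terms and leaves the mean of the
    square of f. *)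
Lemma fourier_parseval (C : numClosedFieldType) (Gam : finZmodType)
    (I : finType) (chi : I -> Gam -> C) (f : Gam -> C) :
  dual_family chi -> (forall x, 0 <= f x <= 1) ->
  \sum_k `|fourier chi f k| ^+ 2 <= 1.
Proof.
move=> dc f01; have [chiD chi1 _ chiS] := dc.
have f0 x : 0 <= f x by case/andP: (f01 x).
under eq_bigr do rewrite (fourier_sqr _ dc f0).
rewrite -mulr_sumr exchange_big/=.
under eq_bigr => x _.
  rewrite exchange_big/=; under eq_bigr => y _.
    rewrite -mulr_sumr chiS subr_eq0; over.
  rewrite (bigD1 x)//= eqxx big1 ?addr0; last first.
    by move=> y yx; rewrite eq_sym (negbTE yx) mulr0.
  over.
have n0 := finzmod_card_gt0 C Gam.
rewrite -mulr_suml mulrCA expr2 -mulrA mulVf ?gt_eqF// mulr1 ler_pdivrMr//.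
rewrite mul1r -sum1_card natr_sum; apply: ler_sum => x _.
by have /andP[h0 h1] := f01 x; rewrite -[X in _ <= X]mulr1 ler_pM.
Qed.

(** Up to normalization the left side is a fourfold convolution of f: by orthogonality it counts,
    with weights, the solutions of x + (y1 - y2) + (y3 - y4) = 0 in the support of f. *)
Lemma fourier_pow4 (C : numClosedFieldType) (Gam : finZmodType)
    (I : finType) (chi : I -> Gam -> C) (f : Gam -> C) x :
  dual_family chi -> (forall y, 0 <= f y) ->
  (forall y1 y2 y3 y4, f y1 != 0 -> f y2 != 0 -> f y3 != 0 -> f y4 != 0 ->
     x + (y1 - y2) + (y3 - y4) != 0) ->
  \sum_k `|fourier chi f k| ^+ 4 * chi k x = 0.
Proof.
move=> dc f0 fx; have [chiD chi1 _ chiS] := dc.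
transitivity (\sum_k #|Gam|%:R^-1 ^+ 4 * \sum_y1 \sum_y2 \sum_y3 \sum_y4
    f y1 * f y2 * (f y3 * f y4) * chi k (x + (y1 - y2) + (y3 - y4))).
  apply: eq_bigr => k _; rewrite -[4%N]/(2 + 2)%N !exprD (fourier_sqr _ dc f0).
  rewrite mulrACA -[LHS]mulrA; congr (_ * _).
  rewrite mulr_suml mulr_suml; apply: eq_bigr => y1 _.
  rewrite mulr_suml mulr_suml; apply: eq_bigr => y2 _.
  rewrite mulr_sumr mulr_suml; apply: eq_bigr => y3 _.
  rewrite mulr_sumr mulr_suml; apply: eq_bigr => y4 _.
  rewrite [chi k (x + _ + _)]chiD [chi k (x + _)]chiD; ring.
rewrite -mulr_sumr exchange_big/= big1 ?mulr0// => y1 _.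
rewrite exchange_big/= big1// => y2 _.
rewrite exchange_big/= big1// => y3 _.
rewrite exchange_big/= big1// => y4 _.
rewrite -mulr_sumr chiS; case: ifPn => [/eqP x0|_]; last by rewrite mulr0.
have [->|n1] := eqVneq (f y1) 0; first by rewrite !mul0r.
have [->|n2] := eqVneq (f y2) 0; first by rewrite mulr0 !mul0r.
have [->|n3] := eqVneq (f y3) 0; first by rewrite mul0r mulr0 mul0r.
have [->|n4] := eqVneq (f y4) 0; first by rewrite !mulr0 mul0r.
by have /eqP := fx _ _ _ _ n1 n2 n3 n4.
Qed.

(** The coefficient of f times [chi k (- x) - 1] is the coefficient of the difference of a translate
    of f and f. *)
Lemma fourier_lipschitz (C : numClosedFieldType) (Gam : finZmodType)
    (I : finType) (chi : I -> Gam -> C) (f : Gam -> C) k x (d : C) :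
  dual_family chi -> (forall y, `|f (y + x) - f y| <= d) ->
  `|fourier chi f k| * `|1 - chi k x| <= d.
Proof.
move=> dc fd; have [chiD chi1 _ chiS] := dc.
have n0 := finzmod_card_gt0 C Gam.
have -> : `|1 - chi k x| = `|chi k (- x) - 1|.
  transitivity (`|chi k (- x)| * `|1 - chi k x|); first by rewrite chi1 mul1r.
  rewrite -normrM mulrBr mulr1 -chiD addNr.
  by rewrite (dual_family0 _ dc).
rewrite -normrM /fourier -mulrA normrM ger0_norm ?invr_ge0 ?(ltW n0)//.
rewrite ler_pdivrMl// mulrBr mulr1.
have -> : (\sum_y f y * chi k y) * chi k (- x) =
    \sum_y f (y + x) * chi k y.
  rewrite (reindex_inj (addIr x)) mulr_suml; apply: eq_bigr => y _.
  by rewrite -mulrA -chiD addrK.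
rewrite -sumrB; apply: le_trans (ler_norm_sum _ _ _) _.
rewrite mulr_natl -sumr_const; apply: ler_sum => y _.
by rewrite -mulrBl normrM chi1 mulr1.
Qed.

(** Without a solution, [fourier_pow4] lets the factor 1 - chi be inserted in the sum of fourth
    powers. The trivial character makes that sum at least c^4. The factor is at most eps on the
    large spectrum; off it, the factor is at most 2 and the squared coefficient at most al^2. By
    Parseval the sum is then at most eps + 2 al^2. *)
Lemma fourier_bogolyubov (C : numClosedFieldType) (Gam : finZmodType)
    (I : finType) (chi : I -> Gam -> C) (f : Gam -> C) (c al eps : C) x :
  dual_family chi -> (forall y, 0 <= f y <= 1) ->
  0 <= c -> 0 <= al -> 0 <= eps ->
  c * #|Gam|%:R <= \sum_y f y ->
  eps + 2 * al ^+ 2 < c ^+ 4 ->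
  (forall k, al <= `|fourier chi f k| -> `|1 - chi k x| <= eps) ->
  exists y1 y2 y3 y4, [/\ f y1 != 0, f y2 != 0, f y3 != 0, f y4 != 0 &
    x + (y1 - y2) + (y3 - y4) = 0].
Proof.
move=> dc f01 c0 al0 eps0 fc ec small; have [chiD chi1 [k0 chik0] chiS] := dc.
have f0 y : 0 <= f y by case/andP: (f01 y).
have n0 := finzmod_card_gt0 C Gam.
apply: contrapT => nex.
have S0 : \sum_k `|fourier chi f k| ^+ 4 * chi k x = 0.
  apply: fourier_pow4 => // y1 y2 y3 y4 n1 n2 n3 n4; apply/eqP => x0.
  by apply: nex; exists y1, y2, y3, y4.
have ck0 : c <= `|fourier chi f k0|.
  rewrite /fourier; under eq_bigr do rewrite chik0 mulr1.
  rewrite ger0_norm; last by apply: mulr_ge0; [rewrite invr_ge0 ltW|apply: sumr_ge0].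
  by rewrite ler_pdivlMl// mulrC.
have c4 : c ^+ 4 <= \sum_k `|fourier chi f k| ^+ 4.
  rewrite (bigD1 k0)//= -[X in X <= _]addr0 lerD//.
    by rewrite lerXn2r ?nnegrE// normr_ge0.
  by apply: sumr_ge0 => k _; rewrite exprn_ge0.
have : c ^+ 4 <= eps + 2 * al ^+ 2.
  apply: le_trans c4 _.
  have -> : \sum_k `|fourier chi f k| ^+ 4 =
      \sum_k `|fourier chi f k| ^+ 4 * (1 - chi k x).
    under [RHS]eq_bigr do rewrite mulrBr mulr1.
    by rewrite sumrB S0 subr0.
  have b0 : 0 <= eps + 2 * al ^+ 2.
    apply: addr_ge0 => //; apply: mulr_ge0; [exact: ler0n|exact: exprn_ge0].
  apply: (@le_trans _ _ (\sum_k `|fourier chi f k| ^+ 2 * (eps + 2 * al ^+ 2))).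
    rewrite -[X in X <= _]ger0_norm; last first.
      under eq_bigr do rewrite mulrBr mulr1.
      rewrite sumrB S0 subr0; apply: sumr_ge0 => k _; exact: exprn_ge0.
    apply: le_trans (ler_norm_sum _ _ _) _; apply: ler_sum => k _.
    rewrite normrM ger0_norm ?exprn_ge0//.
    rewrite -[4%N]/(2 + 2)%N exprD -mulrA ler_wpM2l ?exprn_ge0//.
    have le2 : `|1 - chi k x| <= 2.
      by apply: le_trans (ler_normB _ _) _; rewrite normr1 chi1.
    have le1 : `|fourier chi f k| ^+ 2 <= 1.
      apply: le_trans (fourier_parseval dc f01).
      rewrite (bigD1 k)//= lerDl; apply: sumr_ge0 => j _; exact: exprn_ge0.
    have [le_al|lt_al] := real_leP (ger0_real al0) (normr_real (fourier chi f k)).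
      apply: le_trans (_ : eps <= _); last by rewrite lerDl mulr_ge0// exprn_ge0.
      rewrite -[X in _ <= X]mul1r ler_pM ?exprn_ge0//; exact: small.
    apply: le_trans (_ : 2 * al ^+ 2 <= _); last by rewrite lerDr.
    by rewrite mulrC ler_pM ?exprn_ge0// lerXn2r ?nnegrE// ltW.
  rewrite -mulr_suml -[X in _ <= X]mul1r ler_wpM2r//.
  exact: fourier_parseval.
by move=> /le_lt_trans/(_ ec); rewrite ltxx.
Qed.

(** In characteristic 0 the polynomial X^n - 1 is separable, so it has n distinct roots, and n
    distinct n-th roots of unity include a primitive one. *)
Lemma closed_prim_root_exists (C : numClosedFieldType) n :
  (0 < n)%N -> exists z : C, n.-primitive_root z.
Proof.
pose p : {poly C} := 'X^n - 1; have [r Dp] := closed_field_poly_normal p.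
move=> n_gt0; rewrite (monicP _) ?monicXnsubC// scale1r in Dp.
have rn1 : all n.-unity_root r by apply/allP => z; rewrite -root_prod_XsubC -Dp.
have sz_r : (n < (size r).+1)%N.
  by rewrite -(size_prod_XsubC r id) -Dp size_XnsubC.
have [|z _] := hasP (cyclic.has_prim_root n_gt0 rn1 _ sz_r); last by exists z.
by rewrite -separable.separable_prod_XsubC -Dp cyclotomic.separable_Xn_sub_1// pnatr_eq0 -lt0n.
Qed.

Definition cmod (K : realType) (z : complex K) : K := complex.Re `|z|.

Lemma cmodE (K : realType) (z : complex K) : real_complex K (cmod z) = `|z|.
Proof. by rewrite /cmod normc_def. Qed.

Lemma cmod_le (K : realType) (z : complex K) (r : K) :
  (cmod z <= r) = (`|z| <= real_complex K r).
Proof. by rewrite -cmodE lecR. Qed.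

Lemma cmod_ge0 (K : realType) (z : complex K) : 0 <= cmod z.
Proof. by rewrite -ler0c cmodE. Qed.

(* On a single character, |1 - chi x| expands by 3/2 under doubling as long as
   it stays below 1/2; this survives taking a maximum over characters. *)
Lemma finite_bohr_seminorm (K : realType) (Gam : finZmodType) (I : finType)
    (chi : I -> Gam -> complex K) (f : Gam -> K) (c al eps : K) :
  dual_family chi -> (forall y, 0 <= f y <= 1) ->
  0 <= c -> 0 < al -> 0 <= eps ->
  c * #|Gam|%:R <= \sum_y f y ->
  eps + 2 * al ^+ 2 < c ^+ 4 ->
  exists M : Gam -> K, [/\ zseminorm M,
    forall x, M x <= 2,
    forall x d, (forall y, `|f (y + x) - f y| <= d) -> al * M x <= d,
    forall x, M x <= 1 / 2 -> 3 / 2 * M x <= M (x + x)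
  & forall x, M x <= eps -> exists y1 y2 y3 y4,
      [/\ f y1 != 0, f y2 != 0, f y3 != 0, f y4 != 0 &
        x + (y1 - y2) + (y3 - y4) = 0]].
Proof.
move=> dc f01 c0 al0 eps0 fc ec; have [chiD chi1 _ chiS] := dc.
pose fC y := real_complex K (f y).
pose P k := al <= cmod (fourier chi fC k).
pose M x := \big[Num.max/0]_(k | P k) cmod (1 - chi k x).
have M0 x : 0 <= M x by apply: bigmax_ge_id.
have MP x r : 0 <= r -> (forall k, P k -> cmod (1 - chi k x) <= r) -> M x <= r.
  by move=> r0 h; apply: bigmax_le.
have Mk x k : P k -> cmod (1 - chi k x) <= M x.
  by move=> Pk; apply: (le_bigmax_cond _ (fun k => cmod (1 - chi k x))).
have eN x : M (- x) <= M x.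
  apply: MP => // k Pk; apply: le_trans (Mk _ _ Pk).
  rewrite cmod_le cmodE (dual_familyN _ _ dc) -(rmorph1 Num.conj_op).
  by rewrite -rmorphB/= norm_conjC rmorph1.
exists M; split.
- split=> //.
  + apply/eqP; rewrite eq_le M0 andbT; apply: MP => // k _.
    by rewrite (dual_family0 _ dc) subrr cmod_le normr0.
  + by move=> x; apply/eqP; rewrite eq_le eN -{1}[x]opprK eN.
  + move=> x y; apply: MP => [|k Pk]; first exact: addr_ge0.
    apply: le_trans (lerD (Mk x _ Pk) (Mk y _ Pk)).
    rewrite cmod_le rmorphD/= !cmodE chiD.
    have -> : 1 - chi k x * chi k y = (1 - chi k x) + chi k x * (1 - chi k y).
      by ring.
    by apply: le_trans (ler_normD _ _) _; rewrite normrM chi1 mul1r.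
- move=> x; apply: MP => // k _; rewrite cmod_le.
  apply: le_trans (ler_normB _ _) _.
  by rewrite normr1 chi1 -[1 + 1]/(2%:R : complex K) rmorph_nat.
- move=> x d fd; have d0 : 0 <= d by apply: le_trans (fd 0).
  rewrite -ler_pdivlMl//; apply: MP => [|k Pk].
    by rewrite mulr_ge0// invr_ge0 ltW.
  rewrite ler_pdivlMl//.
  apply: le_trans (_ : cmod (fourier chi fC k) * cmod (1 - chi k x) <= _).
    by rewrite ler_wpM2r// cmod_ge0.
  rewrite -lecR rmorphM/= !cmodE; apply: fourier_lipschitz => // y.
  by rewrite /fC -rmorphB -cmod_le /cmod normc_def/= expr0n addr0 sqrtr_sqr.
- move=> x Mx; rewrite -ler_pdivlMl//; apply: MP => [|k Pk].
    by rewrite mulr_ge0.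
  rewrite ler_pdivlMl//; apply: le_trans (Mk _ _ Pk).
  have h : cmod (1 - chi k x) <= 1 / 2 by apply: le_trans Mx; apply: Mk.
  rewrite chiD -lecR rmorphM/= !cmodE.
  (* The first factor has modulus at least 2 - |1 - chi k x|, hence at least 3/2. *)
  have -> : 1 - chi k x * chi k x = (1 + chi k x) * (1 - chi k x) by ring.
  rewrite normrM; apply: ler_wpM2r => //.
  have -> : 1 + chi k x = 2 - (1 - chi k x) by ring.
  apply: le_trans (lerB_dist _ _); rewrite normr_nat -cmodE.
  have -> : (2 : complex K) = real_complex K 2 by rewrite rmorph_nat.
  by rewrite -rmorphB lecR; lra.
- move=> x Mx.
  have [|||||||y1 [y2 [y3 [y4 [h1 h2 h3 h4 h5]]]]] :=
      @fourier_bogolyubov _ _ _ chi fC (real_complex K c)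
        (real_complex K al) (real_complex K eps) x dc.
  + by move=> y; rewrite /fC -(rmorph1 (real_complex K)) ler0c lecR.
  + by rewrite ler0c.
  + by rewrite ler0c ltW.
  + by rewrite ler0c.
  + by rewrite -rmorph_sum -(rmorph_nat (real_complex K)) -rmorphM lecR.
  + by rewrite -(rmorph_nat (real_complex K) 2) -!rmorphXn -rmorphM -rmorphD ltcR.
  + move=> k; rewrite -cmodE lecR => Pk.
    by rewrite -cmod_le; apply: le_trans Mx; apply: Mk.
  + exists y1, y2, y3, y4; move: h1 h2 h3 h4.
    by rewrite /fC !(fmorph_eq0 (real_complex K)).
Qed.

(** Characters are built from a primitive root of unity and the dot product. If x has a nonzero
    coordinate i, shifting k by the i-th basis vector multiplies the sum over k by a number other
    than 1, so the sum is 0. *)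
Lemma dual_family_torus (C : numClosedFieldType) (n l : nat) :
  exists chi : 'rV['I_l.+2]_n -> 'rV['I_l.+2]_n -> C, dual_family chi.
Proof.
have [w pw] := @closed_prim_root_exists C l.+2 (ltn0Sn _).
pose chi (k x : 'rV['I_l.+2]_n) : C := \prod_i w ^+ (k 0%R i * x 0%R i)%N.
have chiC k x : chi k x = chi x k.
  by apply: eq_bigr => i _; rewrite mulnC.
have chiD k x y : chi k (x + y) = chi k x * chi k y.
  rewrite -big_split/=; apply: eq_bigr => i _; rewrite -exprD -mulnDr mxE.
  by rewrite -(prim_expr_mod pw) -[RHS](prim_expr_mod pw)/= modnMmr.
have w1 : `|w| = 1.
  apply/eqP; rewrite -(@pexpr_eq1 _ _ l.+2)// -normrX prim_expr_order//.
  by rewrite normr1.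
exists chi; split=> //.
- move=> k x; rewrite normr_prod big1// => i _.
  by rewrite normrX w1 expr1n.
- by exists 0 => x; rewrite /chi big1// => i _; rewrite mxE mul0n.
- move=> x; case: ifPn => [/eqP ->|x0].
    rewrite -sumr_const; apply: eq_bigr => k _; rewrite /chi big1// => i _.
    by rewrite mxE muln0.
  have [i xi] : exists i, x 0 i != 0.
    apply/existsP; rewrite -negb_forall; apply: contra x0 => /forallP x0.
    by apply/eqP/rowP => i; rewrite mxE; apply/eqP.
  have chii : chi (delta_mx 0 i) x != 1.
    rewrite /chi (bigD1 i)//= big1 ?mulr1; last first.
      by move=> j ji; rewrite mxE (negbTE ji) andbF mul0n.
    rewrite mxE !eqxx mul1n -(prim_order_dvd pw).
    apply: contra xi => dv; rewrite -val_eqE/= -leqn0 leqNgt.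
    by apply/negP => /dvdn_leq/(_ dv); rewrite leqNgt ltn_ord.
  apply/eqP; move: chii; apply: contraNT => S0.
  rewrite -(inj_eq (mulIf S0)) mul1r mulr_sumr eq_sym.
  rewrite (reindex_inj (addrI (delta_mx 0 i))); apply/eqP.
  by apply: eq_bigr => k _; rewrite chiC chiD !(chiC x).
Qed.

(** * Bohr seminorms on totally bounded subgroups *)

Definition zsubgroup (G : zmodType) (S : set G) : Prop :=
  S 0 /\ forall x y, S x -> S y -> S (x - y).

Lemma zsubgroupN (G : zmodType) (S : set G) x : zsubgroup S -> S x -> S (- x).
Proof. by case=> S0 SB Sx; rewrite -sub0r; apply: SB. Qed.

Lemma zsubgroupD (G : zmodType) (S : set G) x y :
  zsubgroup S -> S x -> S y -> S (x + y).
Proof.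
by move=> gS Sx Sy; rewrite -[y]opprK; apply: gS.2 => //; apply: zsubgroupN.
Qed.

Lemma zsubgroupMn (G : zmodType) (S : set G) x m :
  zsubgroup S -> S x -> S (x *+ m).
Proof.
move=> gS Sx; elim: m => [|m IHm]; first by rewrite mulr0n; case: gS.
by rewrite mulrS; apply: zsubgroupD.
Qed.

Lemma zsubgroup_sum (G : zmodType) (S : set G) (I : Type) (s : seq I)
    (f : I -> G) : zsubgroup S -> (forall i, S (f i)) -> S (\sum_(i <- s) f i).
Proof.
move=> gS Sf; elim/big_rec: _ => [|i x _ Sx]; first by case: gS.
exact: zsubgroupD.
Qed.

Definition covered_by (K : realType) (G : zmodType) (rho : G -> K) (S : set G)
    (r : K) (k : nat) : Prop :=
  exists t : 'I_k -> G, forall x, S x -> exists j, rho (x - t j) < r.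

Definition totally_bounded (K : realType) (G : zmodType) (rho : G -> K)
    (S : set G) : Prop :=
  forall r, 0 < r -> exists k, covered_by rho S r k.

Lemma covered_by_class (K : realType) (G : zmodType) (rho : G -> K)
    (S : set G) (r : K) (k : nat) :
  zseminorm rho -> S 0 -> covered_by rho S r k ->
  exists cl : G -> 'I_k, forall x y, S x -> S y -> cl x = cl y ->
    rho (x - y) < r + r.
Proof.
move=> srho S0 [t tP].
(* Points outside S get an arbitrary class; one exists because S contains 0. *)
have h x : exists j, S x -> rho (x - t j) < r.
  have [Sx|nSx] := pselect (S x); first by have [j] := tP x Sx; exists j.
  by have [j _] := tP 0 S0; exists j => /nSx.
have [cl clP] := choice h; exists cl => x y Sx Sy xy.
have -> : x - y = (x - t (cl x)) - (y - t (cl y)) by rewrite xy opprB addrA subrK.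
by apply: le_lt_trans (zseminormB srho _ _) _; apply: ltrD; apply: clP.
Qed.

(** Dirichlet's pigeonhole argument on the cells visited by multiples of the whole tuple z. *)
Lemma simultaneous_return (K : realType) (G : zmodType) (rho : G -> K)
    (S : set G) (n : nat) (z : 'I_n -> G) (eta : K) :
  zseminorm rho -> zsubgroup S -> totally_bounded rho S ->
  (forall i, S (z i)) -> 0 < eta ->
  exists l, forall i, rho (z i *+ l.+2) <= eta.
Proof.
move=> srho gS tbS Sz eta0.
have [|k /(covered_by_class srho gS.1)[cl clP]] := tbS (eta / 2).
  by rewrite divr_gt0.
pose T := {ffun 'I_n -> 'I_k}.
(* Only even multiples are compared, so that two of them differ by at least 2, as the form [l.+2]
   requires. *)
pose g (m : 'I_#|T|.+1) : T := [ffun i => cl (z i *+ (m * 2)%N)].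
have [m [m' [mm' gmm']]] : exists m m' : 'I_#|T|.+1, (m < m')%N /\ g m = g m'.
  have /injectivePn[m [m' mm' gmm']] : ~~ injectiveb g.
    by apply/injectiveP => /leq_card; rewrite card_ord ltnn.
  have [lt_mm'|lt_mm'|eq_mm'] := ltngtP m m'; first by exists m, m'.
    by exists m', m.
  by move: mm'; rewrite (val_inj eq_mm') eqxx.
exists ((m' - m) * 2).-2 => i.
have -> : (((m' - m) * 2).-2).+2 = (m' * 2 - m * 2)%N by lia.
rewrite mulrnBr; last by lia.
have /ffunP/(_ i) := gmm'; rewrite !ffunE => /esym e.
by apply/ltW; apply: lt_le_trans (clP _ _ _ _ e) _; [exact: zsubgroupMn..|lra].
Qed.

Lemma pigeonhole_class (T : finType) (k : nat) (cl : T -> 'I_k) : (0 < #|T|)%N ->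
  exists p, (#|T| <= k * #|[pred x | cl x == cl p]|)%N.
Proof.
move=> T0.
have cT : (\sum_(j < k) #|[pred x | cl x == j]|)%N = #|T|.
  rewrite -sum1_card (partition_big cl xpredT)//=; apply: eq_bigr => j _.
  by rewrite sum1_card.
have /card_gt0P[p0 _] := T0; have k0 : (0 < k)%N by case: (cl p0) => ? /(leq_trans _); apply.
have [[j cj]|nj] := pselect (exists j, (#|T| <= k * #|[pred x | cl x == j]|)%N).
  have /card_gt0P[p] : (0 < #|[pred x | cl x == j]|)%N.
    by move: cj; case: #|[pred x | _]| => //; rewrite muln0 leqNgt T0.
  by rewrite inE => /eqP e; exists p; rewrite e.
have : (\sum_(j < k) (k * #|[pred x | cl x == j]|) <= \sum_(j < k) #|T|.-1)%N.
  apply: leq_sum => j _; rewrite -ltnS prednK// ltnNge; apply/negP => h.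
  by apply: nj; exists j.
rewrite -big_distrr/= cT sum_nat_const card_ord leq_pmul2l//.
by rewrite leqNgt prednK ?leqnn.
Qed.

Definition tent (K : realType) (r : K) : K := Num.max 0 (1 - r).

Lemma tent_lipschitz (K : realType) (a b : K) :
  `|tent a - tent b| <= `|a - b|.
Proof.
have h (x y : K) : tent x <= tent y + `|x - y|.
  have y0 : 0 <= tent y by rewrite le_max lexx.
  have y1 : 1 - y <= tent y by rewrite le_max lexx orbT.
  have := ler_norm (y - x); rewrite distrC => xy.
  by rewrite ge_max addr_ge0//=; lra.
by rewrite ler_norml; have := h a b; have := h b a; rewrite (distrC b a); lra.
Qed.

Lemma tentP (K : realType) (a : K) : 0 <= a ->
  [/\ 0 <= tent a <= 1, tent a != 0 -> a < 1 & a < 1 / 2 -> 1 / 2 <= tent a].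
Proof.
rewrite /tent => a0; case: (leP (1 - a) 0) => h; split; lra.
Qed.

(** Not a homomorphism: coordinates are read through their representatives below [l.+2], so a
    wrap-around in coordinate i costs [z i *+ l.+2], which [simultaneous_return] makes small. *)
Definition torus_map (G : zmodType) (n l : nat) (z : 'I_n -> G)
    (x : 'rV['I_l.+2]_n) : G := \sum_i z i *+ (x 0%R i).

Lemma zseminorm_modn (K : realType) (G : zmodType) (rho : G -> K) (w : G)
    (a b L : nat) : zseminorm rho -> (a < L)%N -> (b < L)%N ->
  rho (w *+ ((a + b) %% L) - (w *+ a + w *+ b)) <= rho (w *+ L).
Proof.
case=> r0 r00 rN rD aL bL; rewrite -mulrnDr; have [abL|Lab] := ltnP (a + b) L.
  by rewrite modn_small// subrr r00.
have -> : ((a + b) %% L = a + b - L)%N.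
  by rewrite -{1}(subnK Lab) modnDr modn_small//; lia.
by rewrite mulrnBr// addrAC subrr sub0r rN.
Qed.

Lemma torus_mapD (K : realType) (G : zmodType) (rho : G -> K) (n l : nat)
    (z : 'I_n -> G) (eta : K) (x y : 'rV['I_l.+2]_n) :
  zseminorm rho -> 0 <= eta -> (forall i, rho (z i *+ l.+2) <= eta) ->
  rho (torus_map z (x + y) - (torus_map z x + torus_map z y)) <= eta *+ n.
Proof.
move=> srho eta0 zeta; have [r0 r00 rN rD] := srho.
rewrite -big_split -sumrB/= -[n in X in _ <= X]card_ord -sumr_const.
apply: le_trans (zseminorm_sum _ _ _ srho) _; apply: ler_sum => i _.
rewrite mxE/=; apply: le_trans (zeta i).
exact: zseminorm_modn.
Qed.

Lemma zseminorm_tri (K : realType) (G : zmodType) (N : G -> K) :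
  zseminorm N -> forall x y z, N (x - z) <= N (x - y) + N (y - z).
Proof. by case=> _ _ _ ND x y z; rewrite -(subrKA y); apply: ND. Qed.

Lemma zseminorm_addB (K : realType) (G : zmodType) (N : G -> K) :
  zseminorm N ->
  forall x y x' y', N (x + y - (x' + y')) <= N (x - x') + N (y - y').
Proof. by case=> _ _ _ ND x y x' y'; rewrite opprD addrACA; apply: ND. Qed.

Lemma zseminorm_ub (K : realType) (G : zmodType) (rho : G -> K) x y r :
  zseminorm rho -> rho (x - y) <= r -> rho x <= rho y + r.
Proof.
case=> _ _ _ rD xy; rewrite -[X in rho X <= _](subrK y) addrC.
by apply: le_trans (rD _ _) _; rewrite lerD2l.
Qed.

(** The Bogolyubov argument is run on a bump around [psi p], where the class of p is of at least
    average size. That class contains at least 1/k of the torus and the bump is at least 1/2 on it,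
    whence the mean (2k)^-1. *)
Lemma torus_bohr_seminorm (K : realType) (G : zmodType) (rho : G -> K)
    (S : set G) (k n l : nat) (z : 'I_n -> G) (al eps e : K) :
  zseminorm rho -> zsubgroup S -> covered_by rho S (1 / 4) k ->
  (forall i, S (z i)) ->
  0 < al -> 0 <= eps -> eps + 2 * al ^+ 2 < ((2 * k%:R)^-1) ^+ 4 ->
  0 <= e -> e <= 1 / 3 ->
  (forall x y : 'rV['I_l.+2]_n,
    rho (torus_map z (x + y) - (torus_map z x + torus_map z y)) <= e) ->
  exists M : 'rV['I_l.+2]_n -> K, [/\ zseminorm M,
    forall x, M x <= 2,
    forall x, al * M x <= rho (torus_map z x) + e,
    forall x, M x <= 1 / 2 -> 3 / 2 * M x <= M (x + x)
  & forall x, M x <= eps -> rho (torus_map z x) <= 5].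
Proof.
move=> srho gS cS Sz al0 eps0 ale e0 e3 tD.
have [r0 r00 rN rD] := srho.
have [cl clP] := covered_by_class srho gS.1 cS.
set psi := @torus_map G n l z in tD *.
have Spsi x : S (psi x).
  by apply: zsubgroup_sum => // i; apply: zsubgroupMn.
have G0 : (0 < #|{: 'rV['I_l.+2]_n}|)%N by apply/card_gt0P; exists 0.
have [p pP] := pigeonhole_class (fun x => cl (psi x)) G0.
pose f x := tent (rho (psi x - psi p)).
have f01 x : 0 <= f x <= 1 by have [] := tentP (r0 (psi x - psi p)).
have fn0 x : f x != 0 -> rho (psi x - psi p) < 1.
  by have [] := tentP (r0 (psi x - psi p)).
have fe x : forall y, `|f (y + x) - f y| <= rho (psi x) + e.
  move=> y; apply: le_trans (tent_lipschitz _ _) _.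
  apply: le_trans (zseminorm_dist _ _ srho) _.
  rewrite opprB addrA subrK; apply: zseminorm_ub => //.
  by apply: le_trans (tD y x); rewrite [psi y + _]addrC opprD addrA addrAC lexx.
have [chi dchi] := @dual_family_torus (complex K) n l.
have k0 : (0 < k)%N by case: (cl 0) => ? /(leq_trans _); apply.
have [||M [sM M2 Me Mdbl Mf]] :=
    @finite_bohr_seminorm _ _ _ chi f (2 * k%:R)^-1 al eps dchi f01 _ al0 eps0 _ ale.
- by rewrite invr_ge0 mulr_ge0.
- apply: (@le_trans _ _ (\sum_(x in [pred x | cl (psi x) == cl (psi p)]) 1 / 2)).
    rewrite sumr_const mulrC ler_pdivrMr; last by rewrite mulr_gt0// ltr0n.
    apply: le_trans (_ : (k * #|[pred x | cl (psi x) == cl (psi p)]|)%:R <= _).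
      by rewrite ler_nat.
    by rewrite natrM -mulr_natl; lra.
  rewrite [X in _ <= X](bigID (fun x => cl (psi x) == cl (psi p)))/=.
  rewrite -[X in X <= _]addr0 lerD//; last first.
    by apply: sumr_ge0 => x _; have /andP[] := f01 x.
  apply: ler_sum => x /eqP xp; have [_ _] := tentP (r0 (psi x - psi p)).
  by apply; have := clP _ _ (Spsi x) (Spsi p) xp; lra.
exists M; split=> //.
- by move=> x; apply: Me; apply: fe.
- move=> x /Mf[y1 [y2 [y3 [y4 [/fn0 h1 /fn0 h2 /fn0 h3 /fn0 h4 h5]]]]].
  (* Each of the four points is within 1 of q and additivity is used three times, so the bound is 4
     + 3e, at most 5. *)
  set q := psi p in h1 h2 h3 h4.
  have e1 : x + (y1 + y3) = y2 + y4.
    apply/eqP; rewrite -subr_eq0 -[X in _ == X]h5; apply/eqP.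
    by rewrite opprD !addrA [x + y1 + y3 - y2]addrAC.
  have t1 := tD x (y1 + y3); have t2 := tD y1 y3; have t3 := tD y2 y4.
  rewrite e1 zseminormBC// in t1.
  have -> : psi x = psi x + psi (y1 + y3) - psi (y1 + y3) by rewrite addrK.
  have u1 := zseminorm_tri srho (psi x + psi (y1 + y3)) (psi (y2 + y4))
    (psi (y1 + y3)).
  have u2 := zseminorm_tri srho (psi (y2 + y4)) (psi y2 + psi y4)
    (psi (y1 + y3)).
  have u3 := zseminorm_tri srho (psi y2 + psi y4) (q + q) (psi (y1 + y3)).
  have u4 := zseminorm_tri srho (q + q) (psi y1 + psi y3) (psi (y1 + y3)).
  have v1 := zseminorm_addB srho (psi y2) (psi y4) q q.
  have v2 := zseminorm_addB srho q q (psi y1) (psi y3).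
  rewrite (zseminormBC srho q) (zseminormBC srho q (psi y3)) in v2.
  by rewrite zseminormBC// in t2; lra.
Qed.

(** A version of [bohr_seminorm_on] on finitely many points with error eta. The uniform bound 2
    provides compactness for the ultralimit. *)
Definition almost_bohr (K : realType) (G : zmodType) (rho : G -> K)
    (al eps : K) (s : seq G) (eta : K) (N : G -> K) : Prop :=
  [/\ forall x, 0 <= N x <= 2,
      forall x y, x \in s -> y \in s -> x + y \in s -> N (x + y) <= N x + N y + eta,
      forall x, x \in s -> - x \in s -> N (- x) <= N x + eta,
      forall x, x \in s -> al * N x <= rho x + eta
    & (forall x, x \in s -> x + x \in s -> N x <= 1 / 2 ->
         3 / 2 * N x <= N (x + x) + eta) /\
      (forall x, x \in s -> N x <= eps -> rho x <= 5)].

(** The elements of s are images of basis vectors of a torus of dimension [size s], and N is the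
    torus seminorm read along this lift. *)
Lemma almost_bohr_exists (K : realType) (G : zmodType) (rho : G -> K)
    (S : set G) (k : nat) (al eps : K) (s : seq G) (eta : K) :
  zseminorm rho -> zsubgroup S -> totally_bounded rho S ->
  covered_by rho S (1 / 4) k ->
  0 < al -> al <= 1 -> 0 <= eps -> eps + 2 * al ^+ 2 < ((2 * k%:R)^-1) ^+ 4 ->
  (forall x, x \in s -> S x) -> 0 < eta ->
  exists N, almost_bohr rho al eps s eta N.
Proof.
move=> srho gS tbS cS al0 al1 eps0 ale sS eta0.
have [r0 r00 rN rD] := srho.
pose n := size s; pose z (i : 'I_n) := nth 0 s i.
(* The bound 1/3 serves [torus_bohr_seminorm]; the other makes the total error 3e / al at most
   eta. *)
pose e := Num.min (1 / 3) (al * eta / 3).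
have e0 : 0 < e by rewrite lt_min !divr_gt0// mulr_gt0.
have e13 : e <= 1 / 3 by rewrite ge_min lexx.
have eal : 3 * e <= al * eta.
  have : e <= al * eta / 3 by rewrite ge_min lexx orbT.
  by lra.
have Sz i : S (z i) by apply: sS; apply: mem_nth.
have n1 : 0 < n.+1%:R :> K by rewrite ltr0n.
have [|l zl] := simultaneous_return (eta := e / n.+1%:R) srho gS tbS Sz.
  by rewrite divr_gt0.
have tD (x y : 'rV['I_l.+2]_n) :
    rho (torus_map z (x + y) - (torus_map z x + torus_map z y)) <= e.
  apply: le_trans (torus_mapD _ _ srho _ zl) _; first by rewrite divr_ge0// ltW.
  rewrite -[_ *+ n]mulr_natr -mulrA ler_piMr// ?(ltW e0)//.
  by rewrite ler_pdivrMl// mulr1 ler_nat.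
have [M [sM M2 Mal Mdbl M5]] :=
  torus_bohr_seminorm srho gS cS Sz al0 eps0 ale (ltW e0) e13 tD.
have [M0 M00 MN MD] := sM.
set psi := @torus_map G n l z in Mal M5 tD.
have psi0 : psi 0 = 0.
  by rewrite /psi /torus_map big1// => i _; rewrite mxE.
(* M (u - v) is controlled by rho of its image, so M nearly factors through [psi]. This makes up for
   the lift [vec] not being additive. *)
have Muv u v : M u <= M v + (rho (psi u - psi v) + 2 * e) / al.
  apply: le_trans (_ : M v + M (u - v) <= _).
    by rewrite -{1}[u](subrK v) addrC.
  rewrite lerD2l ler_pdivlMr// mulrC.
  apply: le_trans (Mal _) _.
  have t := tD (u - v) v; rewrite subrK in t.
  have : psi (u - v) = (psi (u - v) + psi v) - psi v by rewrite addrK.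
  have := zseminorm_tri srho (psi (u - v) + psi v) (psi u) (psi v).
  by move=> + ->; rewrite zseminormBC// in t; lra.
have Muv3 u v : rho (psi u - psi v) <= e -> M u <= M v + eta.
  move=> h; apply: le_trans (Muv u v) _; rewrite lerD2l ler_pdivrMr//.
  by rewrite [eta * _]mulrC; lra.
pose vec (x : G) : 'rV['I_l.+2]_n := \row_i (nat_of_bool (i == index x s :> nat))%:R.
have psivec x : x \in s -> psi (vec x) = x.
  move=> xs; have ix : (index x s < n)%N by rewrite index_mem.
  rewrite /psi /torus_map (bigD1 (Ordinal ix))//= big1 ?addr0.
    by rewrite mxE/= eqxx/= /z nth_index.
  move=> i ni; rewrite mxE; case: eqP => //= h.
  by move: ni; rewrite -val_eqE/= h eqxx.
exists (fun x => M (vec x)); split.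
- by move=> x; rewrite M0 M2.
- move=> x y xs ys xys; apply: le_trans (_ : M (vec x + vec y) + eta <= _).
    apply: Muv3; rewrite zseminormBC//; apply: le_trans (tD (vec x) (vec y)).
    by rewrite !psivec.
  by rewrite lerD2r; apply: MD.
- move=> x xs nxs; rewrite -(MN (vec x)); apply: Muv3.
  rewrite zseminormBC//; have := tD (- vec x) (vec x).
  by rewrite addNr psi0 !psivec// sub0r rN opprK.
- move=> x xs; apply: le_trans (Mal _) _; rewrite psivec// lerD2l.
  by apply: le_trans (_ : al * eta <= _); [lra|rewrite ler_piMl// ltW].
- split=> x xs.
    move=> xxs /Mdbl; move/le_trans; apply; apply: Muv3.
    by apply: le_trans (tD (vec x) (vec x)); rewrite !psivec.
  by move=> /M5; rewrite psivec.
Qed.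

(** The premises on N x are strict here and weak in [almost_bohr]: a strict bound on the limit holds
    for the approximations near it. *)
Definition bohr_seminorm_on (K : realType) (G : zmodType) (rho : G -> K)
    (al eps : K) (S : set G) (N : G -> K) : Prop :=
  [/\ forall x, 0 <= N x,
      forall x y, S x -> S y -> N (x + y) <= N x + N y,
      forall x, S x -> N (- x) = N x,
      forall x, S x -> al * N x <= rho x
    & (forall x, S x -> N x < 1 / 2 -> 3 / 2 * N x <= N (x + x)) /\
      (forall x, S x -> N x < eps -> rho x <= 5)].

(** Tails of the directed set of finite parts of S, ordered by inclusion, paired with tolerances
    tending to 0. *)
Definition seq_filter (T : choiceType) (K : realType) (S : set T) :
    set_system (seq T * K) :=
  [set A : set (seq T * K) | exists s0 : seq T, exists e0 : K,
    [/\ 0 < e0, (forall x, x \in s0 -> S x) &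
    forall (s : seq T) (e : K), (forall x, x \in s -> S x) -> {subset s0 <= s} -> 0 < e ->
      e <= e0 -> A (s, e)]].

Lemma seq_filter_proper (T : choiceType) (K : realType) (S : set T) :
  ProperFilter (@seq_filter T K S).
Proof.
split.
  by move=> [s0 [e0 [e00 s0S]]] /(_ s0 e0 s0S (fun x h => h) e00 (lexx _)).
split.
- by exists [::], 1; split.
- move=> A B [s1 [e1 [e10 s1S A1]]] [s2 [e2 [e20 s2S A2]]].
  exists (s1 ++ s2), (Num.min e1 e2); split.
  + by rewrite lt_min e10.
  + by move=> x; rewrite mem_cat => /orP[/s1S|/s2S].
  + move=> s e sS ss e0; rewrite le_min => /andP[h1 h2]; split.
      by apply: A1 => // x xs; apply: ss; rewrite mem_cat xs.
    by apply: A2 => // x xs; apply: ss; rewrite mem_cat xs orbT.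
- move=> A B AB [s1 [e1 [e10 s1S A1]]]; exists s1, e1; split=> // s e *.
  by apply: AB; apply: A1.
Qed.

Lemma ultra_fmap (T T' : Type) (f : T -> T') (F : set_system T) :
  UltraFilter F -> UltraFilter (f @ F).
Proof.
move=> FU; have FF := @ultra_proper _ _ FU.
split=> [|G GF fG]; first exact: fmap_proper_filter.
apply/seteqP; split=> // A GA.
have [//|nA] := in_ultra_setVsetC (f @^-1` A) FU.
have : G (~` A) by apply: fG.
move=> /(filterI GA); rewrite setICr => G0.
by have := @filter_not_empty _ _ GF.
Qed.

Lemma ler_cvg_near (K : realType) (T : Type) (F : set_system T) (f g : T -> K)
    (l l' : K) :
  ProperFilter F -> f @ F --> l -> g @ F --> l' ->
  (\forall x \near F, f x <= g x) -> l <= l'.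
Proof.
move=> FF fl gl fg; rewrite -subr_ge0; apply: cvgr_to_ge (cvgB gl fl) _.
by apply: filterS fg => x; rewrite subr_ge0.
Qed.

(** N is the pointwise limit of the almost Bohr functions along an ultrafilter refining
    [seq_filter]. Any finite set of points of S is eventually covered and the errors tend to 0, so
    each inequality becomes exact. *)
Lemma bohr_seminorm_exists (K : realType) (G : zmodType) (rho : G -> K)
    (S : set G) (k : nat) (al eps : K) :
  zseminorm rho -> zsubgroup S -> totally_bounded rho S ->
  covered_by rho S (1 / 4) k ->
  0 < al -> al <= 1 -> 0 <= eps -> eps + 2 * al ^+ 2 < ((2 * k%:R)^-1) ^+ 4 ->
  exists N, bohr_seminorm_on rho al eps S N.
Proof.
move=> srho gS tbS cS al0 al1 eps0 ale.
have pF := @seq_filter_proper G K S.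
have [U [uU sFU]] := ultraFilterLemma pF.
have pU : ProperFilter U by case: uU.
have h (p : seq G * K) : exists N : G -> K, (forall x, 0 <= N x <= 2) /\
    ((forall x, x \in p.1 -> S x) -> 0 < p.2 ->
     almost_bohr rho al eps p.1 p.2 N).
  have [[pS p0]|np] := pselect ((forall x, x \in p.1 -> S x) /\ 0 < p.2).
    have [N NP] := almost_bohr_exists srho gS tbS cS al0 al1 eps0 ale pS p0.
    by exists N; split=> //; case: NP.
  (* Pairs outside the range of the construction get the zero function, which keeps all values in
     [0, 2]. *)
  exists (fun=> 0); split; first by move=> x; rewrite lexx ler0n.
  by move=> h1 h2; case: np.
have [Np NpP] := choice h.
have cvgU x : exists l : K, (Np^~ x : seq G * K -> K) @ U --> l.
  have := @segment_compact K 0 2; rewrite compact_ultra => /(_ ((Np^~ x : seq G * K -> K) @ U)).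
  case; first exact: ultra_fmap.
    have : \forall p \near U, `[0, 2]%classic (Np p x).
      by apply: nearW => p; rewrite /= in_itv/=; have [] := NpP p.
    by [].
  by move=> l [_ ?]; exists l.
have {h cvgU} [N NP] := choice cvgU.
have UP (s0 : seq G) (e0 : K) : (forall x, x \in s0 -> S x) -> 0 < e0 ->
    U [set p : seq G * K | [/\ {subset s0 <= p.1}, 0 < p.2, p.2 <= e0 &
      almost_bohr rho al eps p.1 p.2 (Np p)]].
  move=> s0S e00; apply: sFU; exists s0, e0; split=> // s e sS ss e_0 ee.
  by split=> //; have [_] := NpP (s, e); apply.
have cvgC (r : K) : (fun=> r) @ U --> r by exact: cvg_cst.
have Ule x y (a b c : K) (s0 : seq G) : (forall x, x \in s0 -> S x) ->
    (forall p eta, {subset s0 <= p.1} -> almost_bohr rho al eps p.1 eta (Np p) ->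
       a * Np p x <= b * Np p y + c + eta) -> a * N x <= b * N y + c.
  move=> s0S le_p; apply/ler_addgt0Pr => e e0.
  apply: (@ler_cvg_near _ _ U (fun p => a * Np p x)
    (fun p => b * Np p y + c + e)) => //.
  - exact: cvgM.
  - by apply: cvgD => //; apply: cvgD => //; apply: cvgM.
  - apply: filterS (UP _ _ s0S e0) => p [sp p0 pe].
    by move=> /(le_p _ _ sp)/le_trans; apply; rewrite lerD2l.
have sub1 (x : G) (t : seq G) : {subset [:: x] <= t} -> x \in t.
  by apply; rewrite mem_head.
have Np0 p x : 0 <= Np p x by have [/(_ x)/andP[]] := NpP p.
exists N; split.
- by move=> x; apply: cvgr_to_ge (NP x) _; apply: nearW.
- move=> x y Sx Sy; apply/ler_addgt0Pr => e e0.
  have s0S : forall w, w \in [:: x; y; x + y] -> S w.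
    move=> w; rewrite !inE => /or3P[] /eqP -> //; exact: zsubgroupD.
  apply: (@ler_cvg_near _ _ U (fun p => Np p (x + y))
    (fun p => Np p x + Np p y + e)) => //.
  - by apply: cvgD => //; apply: cvgD.
  - apply: filterS (UP _ _ s0S e0) => p [sp p0 pe [_ h _ _ _]].
    by apply: le_trans (h _ _ _ _ _) _; rewrite ?lerD2l// sp// !inE eqxx ?orbT.
- have NN x : S x -> N (- x) <= N x.
    move=> Sx; rewrite -[N (- x)]mul1r -[N x]mul1r -[1 * N x]addr0.
    apply: (Ule _ _ _ _ _ [:: x; - x]).
      by move=> w; rewrite !inE => /orP[] /eqP -> //; apply: zsubgroupN.
    move=> p eta sp [_ _ h _ _]; rewrite !mul1r addr0.
    by apply: h; rewrite sp// !inE eqxx ?orbT.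
  move=> x Sx; apply/eqP; rewrite eq_le NN//= -{1}[x]opprK NN//.
  exact: zsubgroupN.
- move=> x Sx; rewrite -[rho x]add0r -(mul0r (N x)).
  apply: (Ule _ _ _ _ _ [:: x]).
    by move=> w; rewrite inE => /eqP ->.
  by move=> p eta /sub1 xp [_ _ _ h _]; rewrite mul0r add0r; apply: h.
- split=> x Sx.
    move=> Nx; apply/ler_addgt0Pr => e e0.
    have s0S : forall w, w \in [:: x; x + x] -> S w.
      move=> w; rewrite !inE => /orP[] /eqP -> //; exact: zsubgroupD.
    apply: (@ler_cvg_near _ _ U (fun p => 3 / 2 * Np p x)
      (fun p => Np p (x + x) + e)) => //.
    + exact: cvgM.
    + exact: cvgD.
    + have lt_p : U [set p | Np p x < 1 / 2].
        exact: (@cvgr_lt _ _ U _ (Np^~ x) _ (NP x) _ Nx).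
      apply: filterS (filterI lt_p (UP _ _ s0S e0)).
      move=> p [/ltW px [sp p0 pe [_ _ _ _ [h _]]]].
      by apply: le_trans (h _ _ _ px) _; rewrite ?lerD2l// sp// !inE eqxx ?orbT.
  move=> Nx; have lt_p : U [set p | Np p x < eps].
    exact: (@cvgr_lt _ _ U _ (Np^~ x) _ (NP x) _ Nx).
  have s0S : forall w, w \in [:: x] -> S w by move=> w; rewrite inE => /eqP ->.
  have [p [/ltW px [/sub1 xp _ _ [_ _ _ _ [_ h]]]]] :=
    filter_ex (filterI lt_p (UP _ _ s0S ltr01)).
  exact: h.
Qed.

(** * Trapping cyclic subgroups *)

Lemma bohr_constants (K : realType) (k : nat) : (0 < k)%N ->
  exists al eps : K, [/\ 0 < al, al <= 1, 0 < eps &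
    eps + 2 * al ^+ 2 < ((2 * k%:R)^-1) ^+ 4].
Proof.
move=> k0; set c : K := (2 * k%:R)^-1.
have k1 : 1 <= k%:R :> K by rewrite ler1n.
have c0 : 0 < c by rewrite invr_gt0; lra.
have c1 : c <= 1 by rewrite invf_le1; lra.
have c2 : c ^+ 2 <= 1 by rewrite expr_le1// ltW.
have c20 : 0 < c ^+ 2 by rewrite exprn_gt0.
have c40 : 0 < c ^+ 4 by rewrite exprn_gt0.
(* With these values eps + 2 al^2 is c^4 / 4 + c^4 / 2. *)
exists (c ^+ 2 / 2), (c ^+ 4 / 4); split; lra.
Qed.

Lemma covered_by_gt0 (K : realType) (G : zmodType) (rho : G -> K) (S : set G)
    (r : K) (k : nat) : S 0 -> covered_by rho S r k -> (0 < k)%N.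
Proof. by move=> S0 [t /(_ _ S0)[j _]]; case: j => ? /(leq_trans _); apply. Qed.

Lemma covered_by_sub (K : realType) (G : zmodType) (rho : G -> K)
    (S S' : set G) (r : K) (k : nat) :
  S `<=` S' -> covered_by rho S' r k -> covered_by rho S r k.
Proof. by move=> SS' [t tP]; exists t => x /SS'; apply: tP. Qed.

Lemma totally_bounded_sub (K : realType) (G : zmodType) (rho : G -> K)
    (S S' : set G) :
  S `<=` S' -> totally_bounded rho S' -> totally_bounded rho S.
Proof.
move=> SS' tb r r0; have [k ck] := tb r r0; exists k.
exact: covered_by_sub ck.
Qed.

Lemma totally_boundedZ (K : realType) (G : zmodType) (rho : G -> K)
    (S : set G) (lam : K) : 0 < lam ->
  totally_bounded rho S -> totally_bounded (fun x => lam * rho x) S.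
Proof.
move=> lam0 tb r r0; have [|k [t tP]] := tb (r / lam); first by rewrite divr_gt0.
exists k, t => x Sx; have [j xj] := tP x Sx; exists j.
by rewrite mulrC -ltr_pdivlMr.
Qed.

Lemma is_seminorm_ball (K : realType) (G : topologicalZmodType)
    (rho : G -> K) x r : is_seminorm rho -> 0 < r ->
  nbhs x [set y | rho (y - x) < r].
Proof.
move=> srho r0; have : nbhs (x - x) [set w | rho w < r].
  by rewrite subrr; apply: is_seminorm_nbhs => //; case: srho => _ _ -> _ _.
move=> /(@sub_continuous G (x, x)) [[P Q] [/= Px Qx] PQ].
apply: filterS Px => y Py; apply: (PQ (y, x)); split=> //=.
exact: nbhs_singleton.
Qed.

Lemma compact_totally_bounded (K : realType) (G : topologicalZmodType)
    (rho : G -> K) (C : set G) :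
  is_seminorm rho -> compact C -> totally_bounded rho C.
Proof.
move=> srho /compact_near_coveringP cC r r0.
have pF := @seq_filter_proper G K setT.
(* Along the filter of growing finite sets of centers, the near-covering form of compactness yields
   a finite subcover. *)
pose near_seq (p : seq G * K) x := exists2 t, t \in p.1 & rho (x - t) < r.
have : \forall p \near @seq_filter G K setT, C `<=` near_seq p.
  apply: cC.
  move=> x Cx; exists ([set y | rho (y - x) < r],
    [set p : seq G * K | x \in p.1]) => /=.
    split; last by exists [:: x], 1; split=> // s e _ + _ _; apply; rewrite mem_head.
    exact: is_seminorm_ball.
  by move=> [y p] /= [h1 h2]; exists x.
move=> [s0 [e0 [e00 _ /(_ s0 e0)]]] h.
have {}h := h (fun _ _ => I) (fun _ h => h) e00 (lexx _).
exists (size s0), (fun i : 'I_(size s0) => nth 0 s0 i) => x /h[t ts0 xt].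
have it : (index t s0 < size s0)%N by rewrite index_mem.
by exists (Ordinal it); rewrite /= nth_index.
Qed.

(** A positive value would grow by 3/2 at each doubling and leave the bound 1/2; the linear growth
    recorded in [grow] is enough. *)
Lemma bohr_zero (K : realType) (G : zmodType) (rho : G -> K) (al eps : K)
    (S : set G) (N : G -> K) (z : G) :
  zsubgroup S -> bohr_seminorm_on rho al eps S N -> S z ->
  (forall m, N (z *+ m) < 1 / 2) -> N z = 0.
Proof.
move=> gS [N0 ND _ _ [Ndbl _]] Sz zm; apply/eqP; rewrite eq_le N0 andbT.
rewrite leNgt; apply/negP => Nz.
have grow m : (m%:R / 2 + 1) * N z <= N (z *+ 2 ^ m).
  elim: m => [|m IHm]; first by rewrite mul0r add0r mul1r.
  rewrite expnS mul2n -addnn mulrnDr.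
  apply: le_trans (Ndbl _ _ _); [|exact: zsubgroupMn|exact: zm].
  apply: le_trans (_ : 3 / 2 * ((m%:R / 2 + 1) * N z) <= _); last first.
    by rewrite ler_wpM2l.
  rewrite mulrA ler_wpM2r// -natr1.
  have : 0 <= m%:R :> K by [].
  by lra.
have := grow (Num.bound (N z)^-1); have := zm (2 ^ Num.bound (N z)^-1)%N.
have : (N z)^-1 < (Num.bound (N z)^-1)%:R.
  by apply: archi_boundP; rewrite invr_ge0 ltW.
rewrite -(ltr_pM2r Nz) mulVf ?gt_eqF//; lra.
Qed.

Fixpoint zspan (G : zmodType) (s : seq G) : set G :=
  if s is z :: s' then [set x | exists m : int, exists2 y, zspan s' y & x = z *~ m + y]
  else [set 0].

Lemma zspan_subgroup (G : zmodType) (s : seq G) : zsubgroup (zspan s).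
Proof.
elim: s => [|z s [IH0 IHB]]; first by split=> //= _ _ -> ->; rewrite subrr.
split; first by exists 0, 0 => //; rewrite mulr0z addr0.
move=> _ _ [m [y sy ->]] [m' [y' sy' ->]]; exists (m - m'), (y - y').
  exact: IHB.
by rewrite mulrzBr opprD addrACA.
Qed.

Lemma zspan_cons (G : zmodType) (z : G) (s : seq G) :
  zspan s `<=` zspan (z :: s).
Proof. by move=> x sx; exists 0, x => //; rewrite mulr0z add0r. Qed.

Lemma zspan_mem (G : zmodType) (z : G) (s : seq G) m : zspan (z :: s) (z *~ m).
Proof. by exists m, 0; [case: (zspan_subgroup s)|rewrite addr0]. Qed.

Lemma zspan_cat (G : zmodType) (s t : seq G) x y :
  zspan s x -> zspan t y -> zspan (s ++ t) (x + y).
Proof.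
elim: s x => [|z s IHs] x /=; first by move=> ->; rewrite add0r.
move=> [m [w sw ->]] ty; exists m, (w + y); last by rewrite addrA.
exact: IHs.
Qed.

Definition small_cyclic (K : realType) (G : zmodType) (rho : G -> K) (be : K)
    : set G := [set z | forall m, rho (z *+ m) <= be].

Lemma small_cyclicMz (K : realType) (G : zmodType) (rho : G -> K) (be : K) z m :
  zseminorm rho -> small_cyclic rho be z -> small_cyclic rho be (z *~ m).
Proof.
case=> _ _ rN _ zbe j; case: m => m; rewrite ?NegzE ?mulrNz -?pmulrn.
  by rewrite -mulrnA.
by rewrite mulNrn rN -mulrnA.
Qed.

(** On each small cyclic subgroup N is at most be / al < 1/2, so [bohr_zero] kills the generators
    and subadditivity kills the span. *)
Lemma bohr_small_cyclic (K : realType) (G : zmodType) (rho : G -> K)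
    (al eps be : K) (S : set G) (N : G -> K) (s : seq G) :
  zseminorm rho -> zsubgroup S -> bohr_seminorm_on rho al eps S N ->
  0 < al -> be < al / 2 ->
  (forall z, z \in s -> small_cyclic rho be z) ->
  zspan s `<=` S -> forall x, zspan s x -> N x = 0.
Proof.
move=> srho gS bN al0 beal; have [N0 ND _ Nal _] := bN.
have [r0 r00 rN rD] := srho.
have N00 : N 0 = 0.
  apply/eqP; rewrite eq_le N0 andbT; have := Nal 0 gS.1.
  by rewrite r00 pmulr_rle0.
elim: s => [|z s IHs] sbe sS x; first by move=> ->.
have szS := subset_trans (@zspan_cons _ z s) sS.
move=> [m [y sy ->]]; apply/eqP; rewrite eq_le N0 andbT.
have Sy : S y by apply: szS.
have Szm : S (z *~ m) by apply: sS; apply: zspan_mem.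
apply: le_trans (ND _ _ Szm Sy) _.
have -> : N y = 0.
  by apply: IHs => // w ws; apply: sbe; rewrite inE ws orbT.
rewrite addr0 (bohr_zero gS bN Szm)// => j.
have := Nal _ (zsubgroupMn j gS Szm).
have zbe : small_cyclic rho be z by apply: sbe; rewrite mem_head.
have := small_cyclicMz m srho zbe j => /[swap] /le_trans/[apply].
by rewrite -ler_pdivlMl// => /le_lt_trans; apply; rewrite ltr_pdivrMl//; lra.
Qed.

(** A bootstrap on the number of generators. The bound 5 for the old span and be < 1 for a new
    generator give at most 6, so the new span stays in C and carries a Bohr seminorm; this vanishes
    on the span, which restores the bound 5. *)
Lemma zspan_small (K : realType) (G : zmodType) (rho : G -> K) (C : set G)
    (k : nat) (al eps be : K) (s : seq G) :
  zseminorm rho -> totally_bounded rho C -> covered_by rho C (1 / 4) k ->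
  [set x | rho x <= 6] `<=` C ->
  0 < al -> al <= 1 -> 0 < eps -> eps + 2 * al ^+ 2 < ((2 * k%:R)^-1) ^+ 4 ->
  be < al / 2 ->
  (forall z, z \in s -> small_cyclic rho be z) ->
  zspan s `<=` [set x | rho x <= 5].
Proof.
move=> srho tbC cC C6 al0 al1 eps0 ale beal.
have [r0 r00 rN rD] := srho.
elim: s => [|z s IHs] sbe; first by move=> _ ->; rewrite /= r00.
have zbe : small_cyclic rho be z by apply: sbe; rewrite mem_head.
have sC : zspan (z :: s) `<=` C.
  move=> x [m [y sy ->]]; apply: C6 => /=; apply: le_trans (rD _ _) _.
  have := small_cyclicMz m srho zbe 1; rewrite mulr1n.
  have /= : rho y <= 5 by apply: IHs sy => w ws; apply: sbe; rewrite inE ws orbT.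
  by lra.
have gS := zspan_subgroup (z :: s).
have [N bN] := bohr_seminorm_exists srho gS (totally_bounded_sub sC tbC)
  (covered_by_sub sC cC) al0 al1 (ltW eps0) ale.
have [_ _ _ _ [_ N5]] := bN.
move=> x sx; apply: (N5 _ sx).
by rewrite (bohr_small_cyclic srho gS bN al0 beal sbe _ sx).
Qed.

Definition cyclic_hull (K : realType) (G : zmodType) (rho : G -> K) (be : K)
    : set G :=
  [set x | exists2 s, forall z, z \in s -> small_cyclic rho be z & zspan s x].

Lemma cyclic_hull_subgroup (K : realType) (G : zmodType) (rho : G -> K)
    (be : K) : zsubgroup (cyclic_hull rho be).
Proof.
split; first by exists [::].
move=> x y [s sbe sx] [t tbe ty]; exists (s ++ t).
  by move=> z; rewrite mem_cat => /orP[/sbe|/tbe].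
by apply: zspan_cat => //; apply: zsubgroupN => //; apply: zspan_subgroup.
Qed.

(* The infimal convolution of a Bohr seminorm on H with a multiple of rho. *)
Lemma extend_bohr_seminorm (K : realType) (G : zmodType) (rho : G -> K)
    (H : set G) (al eps : K) (N : G -> K) :
  zseminorm rho -> zsubgroup H -> 0 < al -> bohr_seminorm_on rho al eps H N ->
  exists sg : G -> K, [/\ zseminorm sg,
    forall x, sg x <= al^-1 * rho x,
    forall x, H x -> N x = sg x
  & forall x r, sg x < r ->
      exists2 h, H h & N h + al^-1 * rho (x - h) < r].
Proof.
move=> srho gH al0 [N0 ND NN Nal _].
have [r0 r00 rN rD] := srho.
have Nrho x : H x -> N x <= al^-1 * rho x.
  by move=> Hx; rewrite ler_pdivlMl//; apply: Nal.
have ia0 : 0 <= al^-1 by rewrite invr_ge0 ltW.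
pose q x := if `[< H x >] then N x else al^-1 * rho x.
have q0 x : 0 <= q x by rewrite /q; case: asboolP => // _; rewrite mulr_ge0.
have qH x : H x -> q x = N x by move=> Hx; rewrite /q; case: asboolP.
have qN x : q (- x) = q x.
  rewrite /q; have -> : `[< H (- x) >] = `[< H x >].
    apply: asbool_equiv_eq; split=> [/(zsubgroupN gH)|]; first by rewrite opprK.
    exact: zsubgroupN.
  by case: asboolP => Hx; rewrite ?rN ?NN.
have qle x : q x <= al^-1 * rho x.
  by rewrite /q; case: asboolP => // /Nrho.
(* The summands in H are collected into h; those outside pay with rho. *)
have split_sum (s : seq G) : exists2 h, H h &
    N h + al^-1 * rho (\sum_(y <- s) y - h) <= \sum_(y <- s) q y.
  elim: s => [|x s [h Hh IHs]].
    exists 0; first exact: gH.1.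
    rewrite !big_nil subrr r00 mulr0 addr0.
    by have := Nrho 0 gH.1; rewrite r00 mulr0.
  rewrite !big_cons; have [Hx|nHx] := pselect (H x).
    exists (x + h); first exact: zsubgroupD.
    rewrite opprD addrACA subrr add0r qH//.
    by have := ND _ _ Hx Hh; lra.
  exists h => //; have -> : q x = al^-1 * rho x by rewrite /q; case: asboolP.
  have : al^-1 * rho (x + \sum_(y <- s) y - h) <=
      al^-1 * (rho x + rho (\sum_(y <- s) y - h)).
    by rewrite ler_wpM2l// -addrA.
  by rewrite mulrDr; lra.
have sgP x r : gen_seminorm q x < r ->
    exists2 h, H h & N h + al^-1 * rho (x - h) < r.
  move=> /(gen_seminorm_lt q0)[s <- sr]; have [h Hh hs] := split_sum s.
  by exists h => //; apply: le_lt_trans sr.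
exists (gen_seminorm q); split=> //.
- exact: gen_seminormP.
- by move=> x; apply: le_trans (gen_seminorm_le _ q0) _.
- move=> x Hx; apply/eqP; rewrite eq_le; apply/andP; split; last first.
    by rewrite -qH//; apply: gen_seminorm_le.
  rewrite leNgt; apply/negP => /sgP[h Hh].
  have Hxh : H (x - h) by apply: gH.2.
  have := ND _ _ Hxh Hh; rewrite subrK; have := Nrho _ Hxh; lra.
Qed.

(** By [zspan_small] the group H generated by all small cyclic subgroups is totally bounded, so it
    has a Bohr seminorm, which extends to G. Where the extension is small, rho is at most be; hence
    a cyclic group on which it stays small lies in H, where [bohr_zero] applies. *)
Lemma trapping_seminorm (K : realType) (G : topologicalZmodType)
    (C U : set G) : nbhs 0 C -> compact C -> nbhs 0 U ->
  exists sg : G -> K, [/\ is_seminorm sg, [set x | sg x <= 1] `<=` C `&` U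
    & forall z, (forall m, sg (z *+ m) <= 1) -> sg z = 0].
Proof.
move=> C0 cC U0.
have [rho1 srho1 rho1CU] := nbhs0_seminorm K (filterI C0 U0).
(* The factor 7 puts the ball rho <= 6 inside rho1 < 1. *)
pose rho x := 7 * rho1 x.
have srho : zseminorm rho by apply: zseminormZ => //; apply: is_seminorm_zseminorm.
have rhoCU : [set x | rho x <= 6] `<=` C `&` U.
  by move=> x; rewrite /rho /= => rx; apply: rho1CU => /=; lra.
have [r0 r00 rN rD] := srho.
have rhoC : [set x | rho x <= 6] `<=` C by move=> x /rhoCU[].
have nrho e : 0 < e -> nbhs 0 [set x | rho x < e].
  move=> e0; have : nbhs 0 [set x | rho1 x < e / 7].
    apply: is_seminorm_nbhs => //; case: srho1 => _ _ -> _ _.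
    by rewrite divr_gt0.
  by apply: filterS => x /=; rewrite /rho; lra.
have srho' : is_seminorm rho by apply: zseminorm_is_seminorm.
have tbC := compact_totally_bounded srho' cC.
have [|k ck] := tbC (1 / 4); first by rewrite divr_gt0.
have [al [eps [al0 al1 eps0 ale]]] :=
  bohr_constants K (covered_by_gt0 (nbhs_singleton C0) ck).
pose be := al / 3.
have be0 : 0 < be by rewrite divr_gt0.
have beal : be < al / 2 by rewrite /be; lra.
have be1 : be <= 1 by rewrite /be; lra.
pose H := cyclic_hull rho be.
have gH : zsubgroup H := cyclic_hull_subgroup rho be.
have H5 : H `<=` [set x | rho x <= 5].
  move=> x [s sbe sx].
  exact: (zspan_small srho tbC ck rhoC al0 al1 eps0 ale beal sbe sx).
have HC : H `<=` C by move=> x /H5 /= h; apply: rhoC => /=; lra.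
(* Chosen so that the bound 5 on [rho2 h] reads rho h <= be / 4. *)
pose lam := 20 / be.
have lam0 : 0 < lam by rewrite divr_gt0.
pose rho2 x := lam * rho x.
have srho2 : zseminorm rho2 by apply: zseminormZ => //; apply: ltW.
have tbH : totally_bounded rho2 H.
  by apply: totally_boundedZ => //; apply: totally_bounded_sub tbC.
have [|k2 ck2] := tbH (1 / 4); first by rewrite divr_gt0.
have [al2 [eps2 [al20 al21 eps20 ale2]]] :=
  bohr_constants K (covered_by_gt0 gH.1 ck2).
have [N bN] := bohr_seminorm_exists srho2 gH tbH ck2 al20 al21 (ltW eps20) ale2.
have [sg [ssg sgrho sgH sgP]] := extend_bohr_seminorm srho2 gH al20 bN.
have [N0 ND NN Nal [_ N5]] := bN.
pose Lam := al2^-1 * lam.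
have Lam0 : 0 < Lam by rewrite mulr_gt0// invr_gt0.
(* In order: the threshold for expansion, the one that bounds [rho2] on H, and the one that makes
   the remainder x - h smaller than be / 4. *)
pose r := Num.min (1 / 2) (Num.min eps2 (Lam * be / 4)).
have rr0 : 0 < r by rewrite !lt_min eps20 divr_gt0// divr_gt0// mulr_gt0.
have r2 : r <= 1 / 2 by rewrite ge_min lexx.
have reps : r <= eps2 by rewrite !ge_min lexx orbT.
have rbe : r <= Lam * be / 4 by rewrite !ge_min lexx !orbT.
have sgr x : sg x < r -> rho x <= be.
  move=> /sgP[h Hh hr].
  have Nh := N0 h; have rh : 0 <= al2^-1 * rho2 (x - h).
    by rewrite mulr_ge0 ?invr_ge0 ?(ltW al20)// /rho2 mulr_ge0// ltW.
  have : rho2 h <= 5 by apply: N5 => //; lra.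
  rewrite /rho2 /lam mulrAC ler_pdivrMr// => h1.
  have h2 : rho (x - h) < be / 4.
    have -> : (rho (x - h) < be / 4) = (Lam * rho (x - h) < Lam * be / 4).
      by rewrite -mulrA ltr_pM2l.
    apply: (lt_le_trans _ rbe).
    by rewrite /Lam -mulrA -/(rho2 (x - h)); lra.
  by have := rD (x - h) h; rewrite subrK; lra.
have sg0 x : 0 <= sg x by case: ssg.
have sgle1 x : (2 / r * sg x <= 1) = (sg x <= r / 2).
  by rewrite mulrAC ler_pdivrMr// mul1r mulrC ler_pdivlMr.
(* The new closed unit ball is sg <= r / 2, strictly inside sg < r. *)
exists (fun x => 2 / r * sg x); split.
- apply: zseminorm_is_seminorm; first by apply: zseminormZ => //; rewrite divr_ge0// ltW.
  move=> e e0; have e1 : 0 < e * r / 2 / Lam by rewrite !divr_gt0// mulr_gt0.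
  apply: filterS (nrho _ e1) => x /=; rewrite ltr_pdivlMr// => rx.
  rewrite mulrAC ltr_pdivrMr//; have := sgrho x.
  by rewrite /rho2 mulrA -/Lam [Lam * _]mulrC; lra.
- move=> x /=; rewrite sgle1 => sx; apply: rhoCU => /=.
  have /sgr : sg x < r by lra.
  by lra.
- move=> z zm.
  have {}zm m : sg (z *+ m) < r by have := zm m; rewrite sgle1; lra.
  have Hz : H z.
    exists [:: z]; first by move=> w; rewrite inE => /eqP -> m; apply: sgr.
    exact: (zspan_mem z [::] 1).
  have Nz : N z = 0.
    apply: (bohr_zero gH bN Hz) => m; rewrite sgH; last exact: zsubgroupMn.
    by have := zm m; lra.
  by rewrite -sgH// Nz mulr0.
Qed.

(** * Escape sets *)

Definition traps (K : realType) (G : zmodType) (sg : G -> K) (c : nat) : Prop :=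
  (1 < c)%N /\
  forall z, (forall j, (j <= c)%N -> sg (z *+ j) <= 1) -> sg z <= 1 / 4.

Lemma traps_leq (K : realType) (G : zmodType) (sg : G -> K) (c d : nat) :
  (c <= d)%N -> traps sg c -> traps sg d.
Proof.
move=> cd [c1 tc]; split; first exact: leq_trans cd.
by move=> z zd; apply: tc => j jc; apply: zd; apply: leq_trans cd.
Qed.

(** Each x in C either has all multiples in the unit ball, so sg x = 0 and sg < 1/4 nearby, or has a
    multiple that escapes, and the same multiple escapes for nearby points. Compactness makes c
    uniform. *)
Lemma traps_exists (K : realType) (G : topologicalZmodType) (sg : G -> K)
    (C : set G) :
  is_seminorm sg -> compact C -> [set x | sg x <= 1] `<=` C ->
  (forall z, (forall m, sg (z *+ m) <= 1) -> sg z = 0) ->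
  exists c, traps sg c.
Proof.
move=> ssg /compact_near_coveringP cC sgC sg0.
have zsg := is_seminorm_zseminorm ssg.
have : \forall c \near \oo, C `<=`
    [set z | (forall j, (j <= c)%N -> sg (z *+ j) <= 1) -> sg z <= 1 / 4].
  apply: cC => x Cx.
  have [xm|/existsNP[m /negP]] := pselect (forall m, sg (x *+ m) <= 1).
    exists ([set y | sg y < 1 / 4], setT) => /=.
      split; last exact: filterT.
      by apply: is_seminorm_nbhs; rewrite ?sg0// divr_gt0.
    by move=> [y c] [/= /ltW].
  rewrite -ltNge => xm.
  (* An m-fold multiple of a perturbation of this size is smaller than the excess over 1. *)
  have r0 : 0 < (sg (x *+ m) - 1) / m.+1%:R by rewrite divr_gt0// subr_gt0.
  exists ([set y | sg (y - x) < (sg (x *+ m) - 1) / m.+1%:R],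
    [set c | (m <= c)%N]) => /=.
    by split; [exact: is_seminorm_ball|exists m].
  move=> [y c] [/= yx mc] /(_ m mc) ym.
  have : sg (x *+ m) <= sg (y *+ m) + sg ((y - x) *+ m).
    apply: zseminorm_ub => //; rewrite zseminormBC// -mulrnBl.
    by [].
  have := zseminormMn m (y - x) zsg; rewrite -mulr_natr => h1 h2.
  have : sg (y - x) * m%:R < sg (x *+ m) - 1; last by lra.
  move: yx; rewrite ltr_pdivlMr//; apply: le_lt_trans.
  by rewrite ler_wpM2l ?ler_nat//; case: zsg.
move=> [c0 _ /(_ (c0 + 2)%N) h]; exists (c0 + 2)%N; split; first by rewrite addn2.
move=> z zc; apply: h => //=; first exact: leq_addr.
by apply: sgC => /=; have := zc 1%N; rewrite mulr1n; apply; rewrite addn2.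
Qed.

Definition escape_set (K : realType) (G : zmodType) (sg : G -> K) (c n : nat)
    : set G := [set x | forall j, (j <= c ^ n)%N -> sg (x *+ j) <= 1 / 4].

Lemma escape_set_le (K : realType) (G : zmodType) (sg : G -> K) (c n : nat) x :
  (1 < c)%N -> escape_set sg c n x -> sg x <= 1 / 4.
Proof.
move=> c1 /(_ 1%N); rewrite mulr1n; apply.
by rewrite expn_gt0 (ltn_trans _ c1).
Qed.

(** Multiples of the sum up to c^(n+1) have size at most 3/4 < 1; trapping improves this to 1/4 for
    multiples up to c^n. *)
Lemma escape_tchain (K : realType) (G : zmodType) (sg : G -> K) (c : nat) :
  zseminorm sg -> traps sg c -> tchain (escape_set sg c).
Proof.
move=> [r0 r00 rN rD] [c1 tc]; split.
- by move=> n j _; rewrite mul0rn r00 divr_ge0.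
- by move=> n x xn j jn; rewrite mulNrn rN; apply: xn.
- move=> n x y z xn yn zn j jn; apply: tc => i ic.
  have ji : (j * i <= c ^ n.+1)%N by rewrite expnSr leq_mul.
  rewrite -mulrnA !mulrnDl.
  have := rD (x *+ (j * i) + y *+ (j * i)) (z *+ (j * i)).
  have := rD (x *+ (j * i)) (y *+ (j * i)).
  by have := xn _ ji; have := yn _ ji; have := zn _ ji; lra.
Qed.

Lemma tchain_sum (G : zmodType) (B : nat -> set G) (n : nat) (I : Type)
    (s : seq I) (f : I -> G) :
  tchain B -> (forall i, B (n + size s)%N (f i)) -> B n (\sum_(i <- s) f i).
Proof.
move=> tB; have [B0 BN B3] := tB; elim: s n => [|i s IHs] n /= sn.
  by rewrite big_nil; apply: B0.
rewrite big_cons -[f i + _]addr0; apply: B3 => //.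
  by apply: tchain_sub (sn i) => //; rewrite addnS ltnS leq_addr.
by apply: IHs => j; rewrite addSnnS.
Qed.

Lemma tchainD (G : zmodType) (B : nat -> set G) (n : nat) x y :
  tchain B -> B n.+1 x -> B n.+1 y -> B n (x + y).
Proof. by case=> B0 _ B3 Bx By; rewrite -[x + y]addr0; apply: B3. Qed.

Lemma escape_nbhs (K : realType) (G : topologicalZmodType) (sg : G -> K)
    (c n : nat) : is_seminorm sg -> nbhs 0 (escape_set sg c n).
Proof.
move=> ssg; have zsg := is_seminorm_zseminorm ssg.
have d0 : 0 < (4 * (c ^ n).+1%:R)^-1 :> K by rewrite invr_gt0 mulr_gt0.
have : nbhs 0 [set x | sg x < (4 * (c ^ n).+1%:R)^-1].
  by apply: is_seminorm_nbhs => //; case: zsg => _ -> _ _.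
apply: filterS => x /= xs j jn; apply: le_trans (zseminormMn _ _ zsg) _.
rewrite -[sg x *+ j]mulr_natr; apply: le_trans (_ : sg x * (c ^ n).+1%:R <= _).
  rewrite ler_wpM2l ?ler_nat//; first by case: zsg.
  exact: leq_trans jn _.
move: xs; rewrite invfM => /ltW; rewrite ler_pdivlMr//.
by rewrite div1r.
Qed.

(* If c^n a and c^n b are close, then every multiple of a - b up to c^(n+2)
   stays in a bounded region, so a - b lies one level deeper. Hence the
   covering number of level n by level n+1 does not depend on n. *)
Lemma escape_cover (K : realType) (G : zmodType) (sg : G -> K) (C : set G)
    (c : nat) :
  zseminorm sg -> totally_bounded sg C -> [set x | sg x <= 1] `<=` C ->
  traps sg c ->
  exists m, forall n, exists b : 'I_m -> G,
    (forall j, escape_set sg c n (b j)) /\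
    (forall a, escape_set sg c n a -> exists j, escape_set sg c n.+1 (a - b j)).
Proof.
move=> ssg tbC sgC tc; have [r0 r00 rN rD] := ssg; have [c1 tcP] := tc.
have [E0 EN E3] := escape_tchain ssg tc.
have c20 : 0 < (c ^ 2)%:R :> K by rewrite ltr0n expn_gt0 (ltn_trans _ c1).
have C0 : C 0 by apply: sgC; rewrite /= r00.
(* Points of one class are then closer than 1 / (4 c^2), so c^2 multiples of their difference stay
   within 1/4. *)
have [|m /(covered_by_class ssg C0)[cl clP]] := tbC (8 * (c ^ 2)%:R)^-1.
  by rewrite invr_gt0 mulr_gt0.
exists m => n.
have h (j : 'I_m) : exists b, escape_set sg c n b /\
    forall a, escape_set sg c n a -> cl (a *+ c ^ n) = j -> cl (b *+ c ^ n) = j.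
  have [[b [bn bj]]|nb] := pselect (exists b, escape_set sg c n b /\ cl (b *+ c ^ n) = j).
    by exists b.
  by exists 0; split=> // a an aj; case: nb; exists a.
have [b bP] := choice h; exists b; split=> [j|a an]; first by have [] := bP j.
exists (cl (a *+ c ^ n)); have [bn /(_ a an erefl) bcl] := bP (cl (a *+ c ^ n)).
set b' := b _ in bn bcl *; have Cn x : escape_set sg c n x -> C (x *+ c ^ n).
  by move=> xn; apply: sgC => /=; have := xn _ (leqnn _); lra.
have small := clP _ _ (Cn _ an) (Cn _ bn) (esym bcl).
rewrite -mulrnBl in small; set d := a - b' in small *.
have small2 q : (q <= c ^ 2)%N -> sg (d *+ c ^ n *+ q) <= 1 / 4.
  move=> qc; apply: le_trans (zseminormMn _ _ ssg) _.
  rewrite -[_ *+ q]mulr_natr.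
  apply: le_trans (_ : sg (d *+ c ^ n) * (c ^ 2)%:R <= _).
    by rewrite ler_wpM2l// ler_nat.
  rewrite -ler_pdivlMr//; apply: le_trans (ltW small) _.
  by rewrite invfM; lra.
move=> j jn; apply: tcP => i ic; rewrite -mulrnA.
have jic : (j * i <= c ^ n.+2)%N by rewrite expnSr leq_mul.
have cn0 : (0 < c ^ n)%N by rewrite expn_gt0 (ltn_trans _ c1).
(* The quotient part contributes at most 1/4 and the remainder part at most 1/4 from each of a and
   b', in total below 1. *)
rewrite (divn_eq (j * i) (c ^ n)) mulrnDr mulnC mulrnA.
have q2 : ((j * i) %/ c ^ n <= c ^ 2)%N.
  rewrite -(mulnK (c ^ 2) cn0) -expnD; apply: leq_div2r.
  by rewrite add2n.
have := small2 _ q2; set y := _ *+ _ in |- *; set w := d *+ (_ %% _).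
have := rD y w.
have rn : ((j * i) %% c ^ n <= c ^ n)%N by rewrite ltnW// ltn_mod.
have := zseminormB ssg (a *+ ((j * i) %% c ^ n)) (b' *+ ((j * i) %% c ^ n)).
rewrite -mulrnBl -/d -/w; have := an _ rn; have := bn _ rn; lra.
Qed.

(** * Products in a locally compact ring *)

Lemma rng_mul0l (R : topologicalRngType) (y : R) : (0 * y)%rng = 0.
Proof.
have := rng_mulDl (0 : R) 0 y; rewrite addr0 => /eqP.
by rewrite -{1}[(0 * y)%rng]addr0 (inj_eq (addrI _)) => /eqP.
Qed.

Lemma rng_mul0r (R : topologicalRngType) (a : R) : (a * 0)%rng = 0.
Proof.
have := rng_mulDr a (0 : R) 0; rewrite addr0 => /eqP.
by rewrite -{1}[(a * 0)%rng]addr0 (inj_eq (addrI _)) => /eqP.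
Qed.

Lemma rng_mulMnl (R : topologicalRngType) (a y : R) n :
  ((a *+ n) * y)%rng = (a * y)%rng *+ n.
Proof.
elim: n => [|n IHn]; first by rewrite !mulr0n rng_mul0l.
by rewrite !mulrS rng_mulDl IHn.
Qed.

Lemma rng_mulMnr (R : topologicalRngType) (a y : R) n :
  (a * (y *+ n))%rng = (a * y)%rng *+ n.
Proof.
elim: n => [|n IHn]; first by rewrite !mulr0n rng_mul0r.
by rewrite !mulrS rng_mulDr IHn.
Qed.

Lemma rng_mul_sumr (R : topologicalRngType) (I : Type) (s : seq I) (P : pred I)
    (a : R) (f : I -> R) :
  (a * (\sum_(i <- s | P i) f i))%rng = \sum_(i <- s | P i) (a * f i)%rng.
Proof.
apply: (big_morph (rng_mul a)); last exact: rng_mul0r.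
by move=> x y; apply: rng_mulDr.
Qed.

Lemma rng_mul_small (K : realType) (R : topologicalRngType) (sg : R -> K)
    (C : set R) (r : K) :
  is_seminorm sg -> compact C -> 0 < r ->
  nbhs 0 [set a : R | forall y, C y -> sg (a * y)%rng < r].
Proof.
move=> ssg /compact_near_coveringP cC r0.
have : \forall a \near (0 : R), C `<=` [set y | sg (a * y)%rng < r].
  apply: cC => y Cy.
  have : nbhs (rng_mul 0 y) [set w | sg w < r].
    apply: is_seminorm_nbhs => //; rewrite rng_mul0l.
    by case: ssg => _ _ -> _ _.
  move=> /(@rng_mul_continuous R (0, y)) [[P Q] [/= P0 Qy] PQ].
  exists (Q, P) => //= -[z a] [/= Qz Pa].
  exact: (PQ (a, z)).
by apply: filterS => a aC y; apply: aC.
Qed.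

Lemma escape_mul (K : realType) (R : topologicalRngType) (sg tau : R -> K)
    (c n : nat) (b y : R) :
  (forall b y, tau b <= 1 / 4 -> sg y <= 1 / 4 -> sg (b * y)%rng <= 1 / 4) ->
  escape_set tau c n b -> sg y <= 1 / 4 -> escape_set sg c n (b * y)%rng.
Proof. by move=> mul bn ys j jn; rewrite -rng_mulMnl; apply: mul => //; apply: bn. Qed.

(* One step of the successive approximation of the coefficients: replacing each
   a_i by a nearby b_k groups the sum into m products b_k y_k with y_k a partial
   sum of the x_i. *)
Lemma escape_step (K : realType) (R : topologicalRngType) (sg tau : R -> K)
    (c m n : nat) (F : finType) (x a : F -> R) :
  zseminorm sg -> traps sg c ->
  (forall b y, tau b <= 1 / 4 -> sg y <= 1 / 4 -> sg (b * y)%rng <= 1 / 4) ->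
  (forall n, exists b : 'I_m -> R,
    (forall j, escape_set tau c n (b j)) /\
    (forall a, escape_set tau c n a -> exists j, escape_set tau c n.+1 (a - b j))) ->
  (forall E : {set F}, sg (\sum_(i in E) x i) <= 1 / 4) ->
  (forall i, escape_set tau c (n + m) (a i)) ->
  exists u a', [/\ escape_set sg c n u,
    forall i, escape_set tau c (n + m).+1 (a' i) &
    \sum_i (a i * x i)%rng = u + \sum_i (a' i * x i)%rng].
Proof.
move=> ssg tsg mul cov xE an; have tB := escape_tchain ssg tsg.
have [b [bn bP]] := cov (n + m)%N.
have [ka kaP] := choice (fun i => bP _ (an i)).
exists (\sum_(j < m) (b j * (\sum_(i | ka i == j) x i))%rng), (fun i => a i - b (ka i)).
split=> //.
- apply: (tchain_sum tB) => j.
  rewrite [index_enum _]unlock -enumT size_enum_ord.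
  apply: escape_mul mul (bn j) _.
  have := xE [set i | ka i == j]%SET.
  by under eq_bigl do rewrite inE.
- have -> : \sum_(j < m) (b j * (\sum_(i | ka i == j) x i))%rng =
      \sum_i (b (ka i) * x i)%rng.
    rewrite [RHS](partition_big ka xpredT)//=; apply: eq_bigr => j _.
    by rewrite rng_mul_sumr; apply: eq_bigr => i /eqP ->.
  rewrite -big_split/=; apply: eq_bigr => i _.
  by rewrite -rng_mulDl addrC subrK.
Qed.

(** Successive corrections lie one level deeper each time, so adding them from the last to the first
    costs one level in all. *)
Lemma escape_iter (K : realType) (R : topologicalRngType) (sg tau : R -> K)
    (c m r n : nat) (F : finType) (x a : F -> R) :
  zseminorm sg -> traps sg c ->
  (forall b y, tau b <= 1 / 4 -> sg y <= 1 / 4 -> sg (b * y)%rng <= 1 / 4) ->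
  (forall n, exists b : 'I_m -> R,
    (forall j, escape_set tau c n (b j)) /\
    (forall a, escape_set tau c n a -> exists j, escape_set tau c n.+1 (a - b j))) ->
  (forall E : {set F}, sg (\sum_(i in E) x i) <= 1 / 4) ->
  (forall i, escape_set tau c (n.+1 + m) (a i)) ->
  exists u a', [/\ escape_set sg c n u,
    forall i, escape_set tau c (n.+1 + m + r) (a' i) &
    \sum_i (a i * x i)%rng = u + \sum_i (a' i * x i)%rng].
Proof.
move=> ssg tsg mul cov xE; have tB := escape_tchain ssg tsg.
elim: r n a => [|r IHr] n a an.
  exists 0, a; split=> //; last by rewrite add0r.
    by case: tB.
  by move=> i; rewrite addn0.
have [u1 [a1 [u1n a1n ->]]] := escape_step ssg tsg mul cov xE an.
have [|u2 [a2 [u2n a2n ->]]] := IHr n.+1 a1.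
  by move=> i; rewrite addSn; apply: a1n.
exists (u1 + u2), a2; split; last by rewrite addrA.
  exact: (tchainD tB).
by move=> i; rewrite addnS -addSn -addSn; apply: a2n.
Qed.

(** The number of refinement rounds depends on F and makes the final coefficients so small that a
    term-by-term estimate suffices; the initial level [2 + m] does not depend on F. *)
Lemma escape_sum (K : realType) (R : topologicalRngType) (sg tau : R -> K)
    (c m : nat) (F : finType) (x a : F -> R) :
  zseminorm sg -> traps sg c ->
  (forall b y, tau b <= 1 / 4 -> sg y <= 1 / 4 -> sg (b * y)%rng <= 1 / 4) ->
  (forall n, exists b : 'I_m -> R,
    (forall j, escape_set tau c n (b j)) /\
    (forall a, escape_set tau c n a -> exists j, escape_set tau c n.+1 (a - b j))) ->
  (forall E : {set F}, sg (\sum_(i in E) x i) <= 1 / 4) ->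
  (forall i, escape_set tau c (2 + m) (a i)) ->
  sg (\sum_i (a i * x i)%rng) <= 1 / 4.
Proof.
move=> ssg tsg mul cov xE an; have tB := escape_tchain ssg tsg.
have [u [a' [u1 a'n ->]]] :=
  @escape_iter _ _ _ _ _ _ (size (index_enum F)) _ _ _ _ ssg tsg mul cov xE an.
apply: (@escape_set_le _ _ _ c 0 _ tsg.1); apply: (tchainD tB) => //.
apply: (tchain_sum tB) => i.
apply: (tchain_sub (n := 2 + m + size (index_enum F)) tB).
  by rewrite -addnA leq_add// leq_addl.
apply: escape_mul mul (a'n i) _.
by have := xE [set i]%SET; rewrite big_set1.
Qed.

(** [sg] measures sums and [tau] coefficients; [tau] is chosen after [sg], so that products of small
    coefficients with C are small. *)
Lemma escape_system (K : realType) (R : topologicalRngType) (U : set R) :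
  locally_compact_space R -> nbhs 0 U ->
  exists (B : nat -> set R) (V : set R), [/\ tchain B, forall n, nbhs 0 (B n),
    B 0%N `<=` U, nbhs 0 V &
    forall n (F : finType) (x a : F -> R), (forall i, V (a i)) ->
      (forall E : {set F}, B n (\sum_(i in E) x i)) ->
      B n (\sum_i (a i * x i)%rng)].
Proof.
move=> lcR U0; have [C C0 cC] := lcR 0.
have [sg [ssg sgCU sg0]] := trapping_seminorm K C0 cC U0.
have zsg := is_seminorm_zseminorm ssg.
have sgC : [set x | sg x <= 1] `<=` C by move=> x /sgCU[].
have W0 := rng_mul_small ssg cC (divr_gt0 ltr01 (ltr0n K 4)).
have [tau [stau tauCW tau0]] := trapping_seminorm K C0 cC W0.
have ztau := is_seminorm_zseminorm stau.
have tauC : [set x | tau x <= 1] `<=` C by move=> x /tauCW[].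
have [c1 tsg1] := traps_exists ssg cC sgC sg0.
have [c2 ttau2] := traps_exists stau cC tauC tau0.
pose c := maxn c1 c2.
have tsg : traps sg c by apply: traps_leq tsg1; rewrite leq_maxl.
have ttau : traps tau c by apply: traps_leq ttau2; rewrite leq_maxr.
have [m cov] := escape_cover ztau (compact_totally_bounded stau cC) tauC ttau.
have mul b y : tau b <= 1 / 4 -> sg y <= 1 / 4 -> sg (b * y)%rng <= 1 / 4.
  move=> b4 y4; apply/ltW; have [|_] := tauCW b; first by rewrite /=; lra.
  by apply; apply: sgC => /=; lra.
exists (escape_set sg c), (escape_set tau c (2 + m)); split.
- exact: escape_tchain.
- by move=> n; apply: escape_nbhs.
- by move=> x /(escape_set_le tsg.1) x4; have [|_ //] := sgCU x; rewrite /=; lra.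
- exact: escape_nbhs.
(* Level n follows from level 0 by replacing each x_i with its j-th multiple. *)
- move=> n F x a aV xE j jn; rewrite -sumrMnl.
  under eq_bigr do rewrite -rng_mulMnr.
  apply: (escape_sum zsg tsg mul cov) => // E.
  by rewrite sumrMnl; apply: xE.
Qed.

(** * Seminormability and the Hirsch property *)

Lemma exp2N_double (K : realType) (M v : K) : 0 <= M -> M < 1 ->
  (forall n, M < 2^-1 ^+ n -> v <= 2^-1 ^+ n) -> v <= 2 * M.
Proof.
move=> M0 M1 Mv; rewrite leNgt; apply/negP => lt_v.
have v0 : 0 < v by apply: le_lt_trans lt_v; rewrite mulr_ge0.
have exn : exists n, 2^-1 ^+ n < v := exists_exp2N_lt v0.
(* For the least exponent whose power lies below v, M is at least that power and v at most twice it: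
   the factor 2 is the cost of dyadic rounding. *)
case: (ex_minnP exn) => -[|n] nv nmin.
  have := Mv 0%N; rewrite expr0 => /(_ M1); move: nv; rewrite expr0; lra.
have vn : v <= 2^-1 ^+ n.
  by rewrite leNgt; apply/negP => /nmin; rewrite ltnn.
have := Mv n.+1; rewrite leNgt nv => h.
have : ~~ (M < 2^-1 ^+ n.+1) by apply/negP => /h.
by rewrite -leNgt exprS; lra.
Qed.

Lemma locally_compact_seminormable (K : realType) (R : topologicalRngType) :
  locally_compact_space R -> unconditionally_seminormable K R.
Proof.
move=> lcR U U0; have [B [V [tB nB BU V0 BV]]] := escape_system K lcR U0.
have [N [sN N1 N2]] := birkhoff_kakutani K tB.
(* The radius 1/2 keeps M below 1, where the dyadic comparison starts. *)
exists N, V, 2, (1 / 2); split=> //.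
- apply: zseminorm_is_seminorm => // e /exists_exp2N_lt[n ne].
  by apply: filterS (nB n) => x /N2/le_lt_trans; apply.
- by move=> x /= Nx; apply: BU; apply: N1; rewrite expr0; lra.
- move=> F x a aV; set M := max_subsum _ _ => M2.
  have xM (E : {set F}) : N (\sum_(i in E) x i) <= M.
    exact: (le_bigmax_cond _ (fun E : {set F} => N (\sum_(i in E) x i))).
  apply: exp2N_double.
  + by apply: le_trans (xM finset.set0); case: sN.
  + by lra.
  + move=> n Mn; apply: N2; apply: BV => // E; apply: N1.
    exact: le_lt_trans (xM E) Mn.
Qed.

(** Outside a finite set F0 all partial sums of x are small and the escape system bounds the
    weighted sum; on F0 continuity of finitely many products suffices. *)
Lemma locally_compact_hirsch (K : realType) (R : topologicalRngType) :
  locally_compact_space R -> hirsch R.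
Proof.
move=> lcR x [l xl] U U0.
have [B [V [tB nB BU V0 BV]]] := escape_system K lcR U0.
have [F0 F0P] := xl _ (nB 2%N).
(* Cauchy criterion: the sum over s is a difference of two sums lying in the translate of [B 2] by
   l. *)
have tail (s : seq nat) : uniq s -> {in s, forall n, n \notin F0} ->
    B 1%N (\sum_(n <- s) x n).
  move=> us sF0; have [u1 u1B e1] := F0P _ (fsubset_refl F0).
  pose J := [fset n in F0 ++ s]%fset.
  have [|u2 u2B e2] := F0P J.
    by apply/fsubsetP => n nF0; rewrite in_fset/= mem_cat nF0.
  have -> : \sum_(n <- s) x n = u2 - u1.
    apply: (addrI (l + u1)); rewrite addrACA subrr addr0 e2 e1 -big_cat/=.
    apply: perm_big; apply: uniq_perm => [||n].
    - rewrite cat_uniq fset_uniq us andbT/=.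
      by apply/hasPn => n /sF0.
    - exact: fset_uniq.
    - by rewrite in_fset.
  by apply: (tchainD tB) => //; have [_ + _] := tB; apply.
(* The level [1 + size F0] pays for adding at most [size F0] terms with [tchain_sum]. *)
pose W := [set a : R | forall n, n \in F0 -> B (1 + size F0)%N (a * x n)%rng].
have W0 : nbhs 0 W.
  have Wn n : nbhs (0 : R) [set a : R | B (1 + size F0)%N (a * x n)%rng].
    have : nbhs (rng_mul 0 (x n)) (B (1 + size F0)%N) by rewrite rng_mul0l.
    move=> /(@rng_mul_continuous R (0, x n)) [[P Q] [/= P0 Qx] PQ].
    apply: filterS P0 => b Pb; apply: (PQ (b, x n)); split=> //=.
    exact: nbhs_singleton.
  have : forall s : seq nat, nbhs (0 : R)
      [set a : R | forall n, n \in s -> B (1 + size F0)%N (a * x n)%rng].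
    elim=> [|n s IHs]; first by apply: filterS (@filterT _ (nbhs (0 : R)) _).
    apply: filterS (filterI (Wn n) IHs) => b [bn bs] k.
    by rewrite inE => /orP[/eqP ->|/bs].
  by apply.
exists (V `&` W); first exact: filterI.
move=> F a aVW; apply: BU.
rewrite (big_fsetID _ (mem F0))/=; apply: (tchainD tB).
  set D := [fset n in F | _]%fset.
  have DF n : n \in D -> n \in F /\ n \in F0 by rewrite !inE => /andP.
  (* Terms outside D become 0, since [tchain_sum] asks for a bound at every index. *)
  rewrite big_seq_cond big_mkcond/=; apply: (tchain_sum tB) => n.
  rewrite andbT; case: ifPn => [/DF[nF nF0]|_]; last by case: tB.
  apply: (tchain_sub tB _ ((aVW n nF).2 n nF0)).
  rewrite leq_add2l; apply: fsubset_leq_card.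
  by apply/fsubsetP => k /DF[].
set D := [fset n in F | _]%fset.
have DF n : n \in D -> n \in F /\ n \notin F0 by rewrite !inE => /andP.
rewrite big_seq_fsetE/=; apply: BV => [i|E].
  by have [nF _] := DF _ (fsvalP i); have [] := aVW _ nF.
rewrite -big_enum -(big_map (fun i : D => fsval i) xpredT x); apply: tail.
  by rewrite map_inj_uniq ?enum_uniq//; apply: val_inj.
by move=> n /mapP[i _ ->]; have [] := DF _ (fsvalP i).
Qed.

Theorem theorem5p3 (K : realType) (R : topologicalRngType)
    (lcR : locally_compact_space R) :
  unconditionally_seminormable K R /\ hirsch R.
Proof.
split; first exact: locally_compact_seminormable.
exact: (@locally_compact_hirsch K).
Qed.
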